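(* Suppose Assumptions 1 and 2 of the context hold and $\kappa=\gamma^2\Delta>1$. Set $c_\gamma=\frac{2}{1-\gamma^2}$ and $c_0=\frac{\vartheta^2}{8c_\gamma^2}$. Then for every integer $\ell\ge1$ and every $s\in(0,1)$, $$\mathcal{E}(\ell)\;\le\;\frac{16}{\kappa-1}\;+\;2\,\kappa^{-s\ell}\;+\;\exp\!\Big(-c_0\,(\kappa-1)\,\frac{\kappa^{(1-s)\ell-1}}{\ell^2}\Big)\;+\;\exp\!\Big(-\frac{\vartheta}{2}\,\kappa^{\ell}\Big).$$
   Context: Parameters. Constants $a>b>0$; $\Delta=\frac{a+b}{2}$, assumed $>1$; $\gamma=\frac{a-b}{a+b}\in(0,1)$; $\kappa=\gamma^2\Delta$. Limit object $(T,o,y,X)$. $T$ is a Poisson Galton--Watson tree rooted at $o$: every vertex independently has $\mathrm{Poi}(\Delta)$ children. Labels $y_v\in\{\pm1\}$ follow a broadcast process: $y_o$ is uniform on $\{\pm1\}$ and, independently along edges and of the tree shape, each child has its parent's label with probability $\frac{1+\gamma}{2}$ and the opposite label with probability $\frac{1-\gamma}{2}$. Given the tree and labels, the features $X_v\in\mathbb{R}^d$ are independent with $X_v\sim\mathbb{P}_{y_v}$, where $\mathbb{P}_+,\mathbb{P}_-$ are two given probability laws on $\mathbb{R}^d$. $N_k$ is the set of vertices at graph distance exactly $k$ from $o$. All probabilities and expectations are on this object. Features and classifier. $\rho_\pm$ are the densities of $\mathbb{P}_\pm$ with respect to a common base measure $\mu$; $\psi=\rho_+/\rho_-$; $t(x)=\frac{\rho_+(x)-\rho_-(x)}{\rho_+(x)+\rho_-(x)}\in[-1,1]$,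 so $\log\psi=2\operatorname{artanh}(t)$. For $k\ge0$, $M_k(x)=2\operatorname{artanh}(\gamma^k t(x))$. For $\ell\ge 0$, $$T_\ell=\sum_{k=0}^{\ell}\sum_{v\in N_k}M_k(X_v),\qquad \mathcal{E}(\ell)=\mathbb{P}(y_oT_\ell\le 0)$$ (ties count as errors). $\mathbb{E}_+$ denotes expectation under $X\sim\mathbb{P}_+$. Assumption 1. $\mathbb{P}_+$ and $\mathbb{P}_-$ are mutually absolutely continuous, with densities $\rho_\pm$ with respect to $\mu$, and there is a $\mu$-measure-preserving involution $\tau:\mathbb{R}^d\to\mathbb{R}^d$ with $\rho_-(x)=\rho_+(\tau(x))$ for $\mu$-a.e. $x$. Assumption 2. $\vartheta:=\mathbb{E}_+[t(X)^2]>0$. *)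

(* Defs.v *)
From HB Require Import structures.
From mathcomp Require Import all_boot all_order all_algebra.
From mathcomp Require Import all_classical all_reals all_analysis.

Set Implicit Arguments.
Unset Strict Implicit.
Unset Printing Implicit Defensive.

Import Order.TTheory GRing.Theory Num.Theory.
Import numFieldNormedType.Exports.
Local Open Scope classical_set_scope.
Local Open Scope ring_scope.

(** ** Parameters *)

Section parameters.
Context {R : realType}.

Definition Delta (a b : R) : R := (a + b) / 2.
Definition gamma (a b : R) : R := (a - b) / (a + b).
Definition kappa (a b : R) : R := gamma a b ^+ 2 * Delta a b.

Definition c_gamma (g : R) : R := 2 / (1 - g ^+ 2).
Definition c_zero (g theta : R) : R := theta ^+ 2 / (8 * c_gamma g ^+ 2).

(** The label [+1] is encoded by [true] and [-1] by [false]. *)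
Definition label (e : bool) : R := if e then 1 else -1.

(** Only meaningful on ]-1, 1[. At [u = 1] or [u = -1], where the inverse
    hyperbolic tangent is infinite, the conventions [0^-1 = 0] and [ln 0 = 0]
    give the value 0. For mutually absolutely continuous laws, a feature [X]
    has [|t X| < 1] almost surely, so the choice of this value is immaterial. *)
Definition artanh (u : R) : R := ln ((1 + u) / (1 - u)) / 2.

End parameters.

(** [R^d] with its Borel sigma-algebra, presented as the product one. *)
Definition Rd (R : realType) (d : nat) := d.-tuple (measurableTypeR R).

(** ** Rooted trees

    A vertex is a word over [nat]: the root is [[::]] and the [i]-th child of
    [v] is [i :: v], so that the parent is the tail, a word is read from the
    vertex up to the root, and its length is its distance to the root.
    A family [c : seq nat -> nat] of offspring numbers defines a tree; the
    values of [c] outside of that tree are irrelevant. *)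

Section tree.
Implicit Types (c : seq nat -> nat) (v : seq nat) (F : seq (seq nat)).

Fixpoint in_tree c v : bool :=
  if v is i :: u then in_tree c u && (i < c u)%N else true.

Fixpoint level c (k : nat) : seq (seq nat) :=
  if k is j.+1 then [seq i :: v | v <- level c j, i <- iota 0 (c v)]
  else [:: [::]].

Lemma mem_level c k v : (v \in level c k) = in_tree c v && (size v == k).
Proof.
elim: k v => [|k IHk] v; first by case: v => [|i u] //=; rewrite inE andbF.
apply/allpairsPdep/idP => [[u [i [+ + ->]]]|].
  by rewrite IHk mem_iota /= eqSS => /andP[-> ->] ->.
case: v => [|i u] //= /andP[/andP[uT iu] su].
by exists u, i; rewrite IHk mem_iota uT /=; split.
Qed.

Lemma level_uniq c k : uniq (level c k).
Proof.
elim: k => [|k IHk] //=; apply: allpairs_uniq_dep => //.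
  by move=> v _; exact: iota_uniq.
by move=> [u i] [v j] _ _ /= [-> ->].
Qed.

(** [F] enumerates the vertices of a finite subtree that contains the root and
    is contained in the tree defined by the offspring numbers [c]. *)
Definition finite_subtree c F : Prop :=
  [/\ uniq F, [::] \in F &
      forall v i, i :: v \in F -> v \in F /\ (i < c v)%N].

End tree.

(** ** The labelled Poisson Galton--Watson tree with features *)

Section limit_object.
Context {R : realType} {d : nat} {dO : measure_display}
  {Omega : measurableType dO}.

Definition flip_prob (g : R) (e : seq nat -> bool) (v : seq nat) : R :=
  if v is _ :: u then (if e v == e u then (1 + g) / 2 else (1 - g) / 2)
  else 1 / 2.

(** The joint law of [(T, y, X)], given by the probabilities of the events
    "[T] contains [F], its offspring numbers on [F] are [n], the labels on [F]
    are [e], and the features on [F] lie in the sets [A]", for [F] finite.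
    Conditional laws are written multiplied out. Nothing is assumed about the
    values of [C], [y] and [X] at words that are not vertices of [T]. *)
Record limit_object (P : probability Omega R) (Dl g : R)
    (Pp Pm : probability (Rd R d) R)
    (C : seq nat -> {RV P >-> nat}) (y : seq nat -> {RV P >-> bool})
    (X : seq nat -> {RV P >-> Rd R d}) : Prop := LimitObject {
  offspring_law : forall (F : seq (seq nat)) (n : seq nat -> nat),
    finite_subtree n F ->
    P [set w | forall v, v \in F -> C v w = n v] =
    (\prod_(v <- F) poisson_pmf Dl (n v))%:E ;
  label_law : forall (F : seq (seq nat)) (n : seq nat -> nat)
      (e : seq nat -> bool),
    finite_subtree n F ->
    P [set w | forall v, v \in F -> C v w = n v /\ y v w = e v] =
    (P [set w | forall v, v \in F -> C v w = n v] *
     (\prod_(v <- F) flip_prob g e v)%:E)%E ;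
  feature_law : forall (F : seq (seq nat)) (n : seq nat -> nat)
      (e : seq nat -> bool) (A : seq nat -> set (Rd R d)),
    finite_subtree n F -> (forall v, measurable (A v)) ->
    P [set w | forall v, v \in F ->
                 [/\ C v w = n v, y v w = e v & A v (X v w)]] =
    (P [set w | forall v, v \in F -> C v w = n v /\ y v w = e v] *
     \prod_(v <- F) (if e v then Pp (A v) else Pm (A v)))%E }.

End limit_object.

(** ** Features and classifier *)

Section classifier.
Context {R : realType} {d : nat}.

Definition density_of (mu : {measure set (Rd R d) -> \bar R})
    (Q : probability (Rd R d) R) (rho : Rd R d -> R) : Prop :=
  [/\ measurable_fun [set: Rd R d] rho, (forall x, 0 <= rho x) &
      forall A, measurable A -> Q A = (\int[mu]_(x in A) (rho x)%:E)%E].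

Definition measure_preserving (mu : {measure set (Rd R d) -> \bar R})
    (tau : Rd R d -> Rd R d) : Prop :=
  measurable_fun [set: Rd R d] tau /\
  forall A, measurable A -> mu (tau @^-1` A) = mu A.

Definition assumption1 (mu : {measure set (Rd R d) -> \bar R})
    (Pp Pm : probability (Rd R d) R) (rp rm : Rd R d -> R) : Prop :=
  [/\ Pp `<< Pm, Pm `<< Pp, density_of mu Pp rp, density_of mu Pm rm &
      exists tau : Rd R d -> Rd R d,
        [/\ involutive tau, measure_preserving mu tau &
            {ae mu, forall x, rm x = rp (tau x)}]].

Definition tfun (rp rm : Rd R d -> R) (x : Rd R d) : R :=
  (rp x - rm x) / (rp x + rm x).

Definition vartheta (Pp : probability (Rd R d) R) (rp rm : Rd R d -> R) : R :=
  fine 'E_Pp[fun x => tfun rp rm x ^+ 2].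

Definition Mfun (g : R) (rp rm : Rd R d -> R) (k : nat) (x : Rd R d) : R :=
  2 * artanh (g ^+ k * tfun rp rm x).

Definition Tstat (g : R) (rp rm : Rd R d -> R) (c : seq nat -> nat)
    (x : seq nat -> Rd R d) (l : nat) : R :=
  \sum_(k < l.+1) \sum_(v <- level c k) Mfun g rp rm k (x v).

Definition error_prob {dO : measure_display} {Omega : measurableType dO}
    (P : probability Omega R) (g : R) (rp rm : Rd R d -> R)
    (C : seq nat -> {RV P >-> nat}) (y : seq nat -> {RV P >-> bool})
    (X : seq nat -> {RV P >-> Rd R d}) (l : nat) : \bar R :=
  P [set w | label (y [::] w) *
             Tstat g rp rm (fun v => C v w) (fun v => X v w) l <= 0].

End classifier.

(* Main.v *)
(** A second-moment argument replaces exponential moments.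

Let [L_k] be the sum of the scores [M_k] over level [k], let [m_k] be the mean of
[M_k] under [P_+], and let [w_k = m_k (gamma Delta)^k], the mean of [y_o L_k].
Tilting by [t] and using the symmetry of the two laws gives
[m_k >= 2 gamma^k theta], so [W = w_1 + ... + w_l >= 2 theta kappa^l]. Two
distinct vertices of level [k] with common ancestor at height [j] have label
correlation [gamma^(2 j)]; summing the geometric series in [1 / kappa] yields
[E (y_o L_k - w_k)^2 <= 4 c_gamma^2 kappa^k + w_k^2 / (kappa - 1)].
An error forces the sum of the [y_o L_k - w_k] below [-3 W / 4], which a weighted
Cauchy-Schwarz inequality and Chebyshev control, or the root score [y_o M_0] below
[-W / 4], which the likelihood ratio controls.

Moments are computed for the tree restricted to words over [0, ..., n - 1], where
all sums are finite and bounded; [n] then tends to infinity. The probabilities of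
cylinder events determine these moments: a fresh child multiplies the correlation
of labels by [gamma], and the event that it exists by a Poisson tail. *)

From mathcomp Require Import all_boot all_order all_algebra.
From mathcomp Require Import all_classical all_reals all_analysis.
From mathcomp Require Import measurable_realfun ring lra.
Require Import Defs.

Set Implicit Arguments.
Unset Strict Implicit.
Unset Printing Implicit Defensive.

Import Order.TTheory GRing.Theory Num.Theory.
Import numFieldNormedType.Exports.
Local Open Scope classical_set_scope.
Local Open Scope ring_scope.

(** * Bounded measurable functions *)

Section bounded_measurable.
Context {R : realType} {dT : measure_display} {T : measurableType dT}.
Implicit Types (f h : T -> R).

(** The root is treated apart because [M_0 = log psi] need be neither bounded nor square integrable,
    whereas for [k >= 1] the argument [gamma^k t] stays in [[-gamma, gamma]], so that
    [|M_k| <= 2 c_gamma gamma^k]. With words over finitely many letters, every random variable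
    except the root score is therefore bounded, and expectations can be manipulated linearly without
    further integrability arguments. The laws constrain nothing outside the tree. Labels and
    features away from the root thus enter the moments only together with the indicator that their
    vertices are present, and each such indicator has to be recognised as a cylinder event. Second
    moments give no exponential decay, only a bound [4 / (9 l K)] with [K] the exponent of the
    statement stripped of [kappa^(-s l)]. This suffices, because a probability with such a bound is
    at most [2 z + exp (- K z)] for every [z > 0]; the parameter [s] enters only through the choice
    [z = kappa^(-s l)]. *)

Definition bmeas f := measurable_fun setT f /\ exists K, forall x, `|f x| <= K.

Lemma bmeas_cst (r : R) : bmeas (fun=> r).
Proof. by split; [exact: measurable_cst|exists `|r|]. Qed.

Lemma bmeasD f h : bmeas f -> bmeas h -> bmeas (fun x => f x + h x).
Proof.
move=> [mf [K fK]] [mh [L hL]]; split; first exact: measurable_funD.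
by exists (K + L) => x; apply: le_trans (ler_normD _ _) (lerD _ _).
Qed.

Lemma bmeasM f h : bmeas f -> bmeas h -> bmeas (fun x => f x * h x).
Proof.
move=> [mf [K fK]] [mh [L hL]]; split; first exact: measurable_funM.
by exists (K * L) => x; rewrite normrM; apply: ler_pM.
Qed.

Lemma bmeasZ (r : R) f : bmeas f -> bmeas (fun x => r * f x).
Proof. exact/bmeasM/bmeas_cst. Qed.

Lemma bmeasB f h : bmeas f -> bmeas h -> bmeas (fun x => f x - h x).
Proof.
move=> bf /(bmeasZ (-1)) bh.
by rewrite (_ : (fun x => _) = (fun x => f x + -1 * h x));
  [exact: bmeasD|apply/funext => x; rewrite mulN1r].
Qed.

Lemma bmeas_sqr f : bmeas f -> bmeas (fun x => f x ^+ 2).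
Proof. by move=> bf; exact: bmeasM. Qed.

Lemma bmeas_sum (I : Type) (s : seq I) (F : I -> T -> R) :
  (forall i, bmeas (F i)) -> bmeas (fun x => \sum_(i <- s) F i x).
Proof.
move=> bF; elim: s => [|i s IHs].
  by under eq_fun do rewrite big_nil; exact: bmeas_cst.
by under eq_fun do rewrite big_cons; exact: bmeasD.
Qed.

Lemma bmeas_indic (A : set T) : measurable A -> bmeas \1_A.
Proof.
move=> mA; split; first exact: measurable_indic.
by exists 1 => x; rewrite indicE; case: (_ \in _); rewrite ?normr1 ?normr0.
Qed.

(* Rounding down to a multiple of [e], as a combination of indicators of
   superlevel sets. *)
Lemma layer_approx (e : R) (N : nat) (x : R) : 0 < e -> 0 <= x < N.+1%:R * e ->
  `|x - \sum_(j < N) e * (j.+1%:R * e <= x)%R%:R| <= e.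
Proof.
move=> e0; elim: N x => [|N IHN] x /andP[x0 xN].
  by rewrite big_ord0 subr0 ger0_norm //; lra.
rewrite big_ord_recl mul1r; case: (lerP e x) => ex.
  have := IHN (x - e); rewrite mulrS mulrDl mul1r in xN.
  have -> : 0 <= x - e < N.+1%:R * e by apply/andP; split; lra.
  move=> /(_ isT); rewrite mulr1 opprD addrA.
  congr (`|_ - _| <= _); apply: eq_bigr => j _.
  congr (_ * (_%:R)); congr (nat_of_bool _).
  rewrite lift0 [in RHS]mulrS mulrDl mul1r.
  by rewrite lerBrDl.
rewrite mulr0 add0r big1 => [|j _]; first by rewrite subr0 ger0_norm // ltW.
rewrite lift0; case: lerP => [|_]; last by rewrite mulr0.
rewrite mulrS mulrDl mul1r => h.
have : 0 <= j.+1%:R * e by rewrite mulr_ge0 // ltW.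
by move=> ?; lra.
Qed.

(** Simple functions are uniformly dense among bounded measurable functions, so a linear functional
    that is continuous for the supremum norm is determined by indicators. With [Phi] a difference of
    two expressions, this carries identities from events over to functions. *)
Lemma bmeas_functional_eq0 (Phi : (T -> R) -> R) (L : R) :
  (forall f h, bmeas f -> bmeas h ->
     Phi (fun x => f x + h x) = Phi f + Phi h) ->
  (forall r f, bmeas f -> Phi (fun x => r * f x) = r * Phi f) ->
  (forall f K, bmeas f -> (forall x, `|f x| <= K) -> `|Phi f| <= L * K) ->
  (forall A, measurable A -> Phi \1_A = 0) ->
  forall f, bmeas f -> Phi f = 0.
Proof.
move=> PhiD PhiZ PhiK Phi1.
have Phic (r : R) : Phi (fun=> r) = 0.
  rewrite (_ : (fun=> r) = (fun x => r * \1_(setT : set T) x)).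
    by rewrite PhiZ ?Phi1 ?mulr0//; exact: bmeas_indic.
  by apply/funext => x; rewrite indicT mulr1.
have Phis (I : Type) (s : seq I) (F : I -> T -> R) : (forall i, bmeas (F i)) ->
    (forall i, Phi (F i) = 0) -> Phi (fun x => \sum_(i <- s) F i x) = 0.
  move=> bF F0; elim: s => [|i s IHs].
    by under eq_fun do rewrite big_nil; exact: Phic.
  under eq_fun do rewrite big_cons.
  by rewrite PhiD ?F0 ?IHs ?addr0//; exact: bmeas_sum.
move=> f [mf [K fK]]; have bf : bmeas f by split; [|exists K].
(* [Phi] kills constants, so the function may be shifted to be nonnegative, as rounding down by
   layers requires. *)
set h := fun x => f x + K.
have bh : bmeas h by apply: bmeasD => //; exact: bmeas_cst.
have <- : Phi h = Phi f by rewrite PhiD ?Phic ?addr0//; exact: bmeas_cst.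
have h0 x : 0 <= h x.
  by have := fK x; rewrite ler_norml => /andP[? _]; rewrite /h; lra.
have hK x : h x <= 2 * K.
  by have := fK x; rewrite ler_norml => /andP[_ ?]; rewrite /h; lra.
have small e : 0 < e -> `|Phi h| <= L * e.
  move=> e0; pose N := Num.truncn (2 * K / e).
  pose F (j : 'I_N) x := e * (j.+1%:R * e <= h x)%R%:R : R.
  have FE (j : 'I_N) : F j = (fun x => e * \1_([set x | j.+1%:R * e <= h x]) x).
    apply/funext => x; rewrite /F indicE; congr (_ * _%:R).
    by congr nat_of_bool; apply/idP/idP; rewrite ?inE.
  have mF (j : 'I_N) : measurable [set x | j.+1%:R * e <= h x].
    rewrite -[X in measurable X]setTI; apply: measurable_fun_le => //.
    by case: bh.
  have bF (j : 'I_N) : bmeas (F j) by rewrite FE; apply/bmeasZ/bmeas_indic.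
  have F0 (j : 'I_N) : Phi (F j) = 0.
    by rewrite FE PhiZ ?Phi1 ?mulr0//; exact: bmeas_indic.
  have -> : Phi h = Phi (fun x => h x - \sum_(j < N) F j x).
    rewrite (_ : (fun x => h x - _) =
        (fun x => h x + -1 * \sum_(j < N) F j x)); last first.
      by apply/funext => x; rewrite mulN1r.
    have bS := bmeas_sum (index_enum 'I_N) bF.
    by rewrite PhiD ?PhiZ ?Phis ?mulr0 ?addr0//; exact: bmeasZ.
  apply: PhiK => [|x]; first by apply: bmeasB => //; exact: bmeas_sum.
  apply: layer_approx => //; rewrite h0 /=.
  rewrite -ltr_pdivrMr //; apply: le_lt_trans (truncnS_gt _).
  by rewrite ler_pM2r ?invr_gt0.
apply/eqP; rewrite -normr_eq0 eq_le normr_ge0 andbT.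
have [L0|L0] := lerP L 0.
  by have := small 1 ltr01; rewrite mulr1 => /le_trans; apply.
apply/ler_addgt0Pl => e e0; rewrite addr0.
by have := small (e / L) (divr_gt0 e0 L0); rewrite mulrC divfK ?gt_eqF.
Qed.

End bounded_measurable.

(** * Expectation of bounded functions *)

Section expectation.
Context {R : realType} {dT : measure_display} {T : measurableType dT}.
Variable P : probability T R.
Implicit Types (f h : T -> R) (A : set T).

(** [Rintegral] is the [fine] part of the extended integral, hence additive only under
    integrability, which boundedness supplies. *)
Definition Ex f : R := \int[P]_x f x.

Lemma bmeas_integrable f : bmeas f -> P.-integrable setT (EFin \o f).
Proof.
move=> [mf [K fK]]; apply: measurable_bounded_integrable => //.
  by rewrite -ge0_fin_numE//; exact: fin_num_measure.
exists K; split; first exact: num_real.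
by move=> M KM x _; apply: le_trans (fK x) (ltW KM).
Qed.

Lemma ExD f h : bmeas f -> bmeas h -> Ex (fun x => f x + h x) = Ex f + Ex h.
Proof. by move=> bf bh; rewrite /Ex RintegralD//; exact: bmeas_integrable. Qed.

Lemma ExZ (r : R) f : bmeas f -> Ex (fun x => r * f x) = r * Ex f.
Proof. by move=> bf; rewrite /Ex RintegralZl//; exact: bmeas_integrable. Qed.

Lemma ExB f h : bmeas f -> bmeas h -> Ex (fun x => f x - h x) = Ex f - Ex h.
Proof. by move=> bf bh; rewrite /Ex RintegralB//; exact: bmeas_integrable. Qed.

Lemma Ex_cst (r : R) : Ex (fun=> r) = r.
Proof.
have -> : Ex (fun=> r) = r * fine (P setT) by exact: Rintegral_cst.
by rewrite probability_setT mulr1.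
Qed.

Lemma Ex_sum (I : Type) (s : seq I) (F : I -> T -> R) :
  (forall i, bmeas (F i)) ->
  Ex (fun x => \sum_(i <- s) F i x) = \sum_(i <- s) Ex (F i).
Proof.
move=> bF; elim: s => [|i s IHs].
  by under eq_fun do rewrite big_nil; rewrite big_nil Ex_cst.
by under eq_fun do rewrite big_cons; rewrite big_cons ExD ?IHs//; exact: bmeas_sum.
Qed.

Lemma le_Ex f h : bmeas f -> bmeas h -> (forall x, f x <= h x) -> Ex f <= Ex h.
Proof.
by move=> bf bh fh; apply: le_Rintegral => //; exact: bmeas_integrable.
Qed.

Lemma Ex_bound f K : bmeas f -> (forall x, `|f x| <= K) -> `|Ex f| <= K.
Proof.
move=> bf fK; rewrite ler_norml; apply/andP; split.
  rewrite -[leLHS]Ex_cst; apply: le_Ex => // [|x]; first exact: bmeas_cst.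
  by have := fK x; rewrite ler_norml => /andP[].
rewrite -[leRHS]Ex_cst; apply: le_Ex => // [|x]; first exact: bmeas_cst.
by have := fK x; rewrite ler_norml => /andP[].
Qed.

Lemma Ex_indic A : measurable A -> Ex \1_A = fine (P A).
Proof. by move=> mA; rewrite /Ex /Rintegral integral_indic// setIT. Qed.

Lemma chebyshev_Ex f (r : R) : bmeas f -> 0 < r ->
  fine (P [set x | f x <= - r]) <= Ex (fun x => f x ^+ 2) / r ^+ 2.
Proof.
move=> bf r0; have r20 : 0 < r ^+ 2 by rewrite exprn_gt0.
have mA : measurable [set x | f x <= - r].
  by rewrite -[X in measurable X]setTI; apply: measurable_fun_le => //; case: bf.
rewrite -Ex_indic // ler_pdivlMr // mulrC -ExZ; last exact: bmeas_indic.
apply: le_Ex => [||x]; first exact/bmeasZ/bmeas_indic.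
  exact: bmeas_sqr.
rewrite indicE; case: (boolP (x \in _)) => [|_]; last by rewrite mulr0 sqr_ge0.
by rewrite inE /= mulr1 => fr; nra.
Qed.

End expectation.

(** * Probabilities of cylinder events *)

Section cylinders.
Context {R : realType} {d : nat} {dO : measure_display}
  {Omega : measurableType dO} {P : probability Omega R} {Dl g : R}
  {Pp Pm : probability (Rd R d) R}
  {C : seq nat -> {RV P >-> nat}} {y : seq nat -> {RV P >-> bool}}
  {X : seq nat -> {RV P >-> Rd R d}}.
Hypothesis lim : limit_object Dl g Pp Pm C y X.
Hypothesis Dl_gt0 : 0 < Dl.
Implicit Types (F S : seq (seq nat)) (B : seq nat -> pred nat)
  (e : seq nat -> bool) (A : seq nat -> set (Rd R d)) (v : seq nat).

Definition poi (r : R) (p : pred nat) : R := fine (poisson_prob r 0 [set n | p n]).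

Lemma poi_set (p : pred nat) : poisson_prob Dl 0 [set n | p n] = (poi Dl p)%:E.
Proof. by rewrite /poi fineK//; exact: fin_num_measure. Qed.

Lemma poi_ge0 (p : pred nat) : 0 <= poi Dl p.
Proof. by rewrite -lee_fin -poi_set; exact: measure_ge0. Qed.

Lemma poi_pred1 k : poi Dl (pred1 k) = poisson_pmf Dl k.
Proof.
rewrite /poi (_ : [set n | pred1 k n] = [set k]); last first.
  by apply/seteqP; split => n /= /eqP.
by rewrite /poisson_prob Dl_gt0 esum_set1 ?lee_fin ?poisson_pmf_ge0.
Qed.

Lemma poi_predT : poi Dl predT = 1.
Proof.
rewrite /poi (_ : [set n | predT n] = setT); last by apply/seteqP; split.
by rewrite probability_setT.
Qed.

(* [B] prescribes enough offspring for [F] to be contained in the tree. *)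
Definition forced F B : Prop :=
  [/\ uniq F, [::] \in F & forall i v, i :: v \in F ->
      v \in F /\ forall n, B v n -> (i < n)%N].

Definition cyl F B e A : set Omega :=
  [set w | forall v, v \in F -> [/\ B v (C v w), y v w = e v & A v (X v w)]].

Definition feature_prob (b : bool) : probability (Rd R d) R := if b then Pp else Pm.

Lemma measurable_cyl F B e A : (forall v, measurable (A v)) ->
  measurable (cyl F B e A).
Proof.
move=> mA; rewrite (_ : cyl F B e A = \bigcap_(v in [set` F])
    ((C v @^-1` [set n | B v n] `&` y v @^-1` [set e v]) `&` X v @^-1` A v)).
  apply: fin_bigcap_measurable => // v _.
  by apply: measurableI; [apply: measurableI|]; exact: measurable_funPTI.
apply/seteqP; split => w /= h v vF; have := h v vF.
  by move=> [? ? ?]; split.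
by move=> [[? ?] ?]; split.
Qed.

(** [limit_object] prescribes exact offspring numbers, while [B] allows a set of values at each
    vertex. Countable additivity, applied to one vertex after another, gives the product; [forced]
    keeps [F] inside the tree for every allowed choice, so that the defining laws apply. *)
Lemma cyl_prob F B e A : forced F B -> (forall v, measurable (A v)) ->
  P (cyl F B e A) = ((\prod_(v <- F) poi Dl (B v)) * (\prod_(v <- F) flip_prob g e v)
    * \prod_(v <- F) fine (feature_prob (e v) (A v)))%:E.
Proof.
move=> [uF rF fF] mA.
(* The vertices of [S] obey [B], all others have exactly [n v] children. The induction starts from
   exact prescriptions and relaxes one vertex at a time. *)
pose mix S n : seq nat -> pred nat :=
  fun v => if v \in S then B v else pred1 (n v).
suff mixP S n : uniq S -> {subset S <= F} ->
    (forall i v, i :: v \in F -> v \notin S -> (i < n v)%N) ->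
    P (cyl F (mix S n) e A) =
    ((\prod_(v <- F) poi Dl (mix S n v)) * (\prod_(v <- F) flip_prob g e v)
    * \prod_(v <- F) fine (feature_prob (e v) (A v)))%:E.
  have -> : cyl F B e A = cyl F (mix F (fun=> 0)) e A.
    by apply/seteqP; split => w /= h v vF; have := h v vF; rewrite /mix vF.
  rewrite mixP//; last by move=> i v /fF[-> _].
  congr (_ * _ * _)%:E; rewrite !big_seq; apply: eq_bigr => v vF.
  by rewrite /mix vF.
elim: S n => [|x S IHS] n /=.
  move=> _ _ nF; have subF : finite_subtree n F.
    by split => // v i /[dup] ivF /fF[vF _]; split => //; exact: nF.
  have -> : cyl F (mix [::] n) e A = [set w | forall v, v \in F ->
      [/\ C v w = n v, y v w = e v & A v (X v w)]].
    by apply/seteqP; split => w /= h v /h[/eqP ? ? ?]; split => //; exact/eqP.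
  rewrite (feature_law lim)// (label_law lim)// (offspring_law lim)//.
  rewrite -EFinM (_ : (\prod_(v <- F) _)%E =
      (\prod_(v <- F) fine (feature_prob (e v) (A v)))%:E); last first.
    rewrite -prodEFin; apply: eq_bigr => v _.
    by rewrite fineK; [rewrite /feature_prob; case: (e v)|exact: fin_num_measure].
  rewrite -EFinM; congr (_ * _ * _)%:E; apply: eq_bigr => v _.
  by rewrite /mix in_nil poi_pred1.
move=> /andP[xS uS] SF nF.
have xF : x \in F by apply: SF; rewrite inE eqxx.
pose nx m v := if v == x then m else n v.
pose c := (\prod_(v <- F | v != x) poi Dl (mix (x :: S) n v))
  * (\prod_(v <- F) flip_prob g e v)
  * \prod_(v <- F) fine (feature_prob (e v) (A v)).
have Em m : B x m -> P (cyl F (mix S (nx m)) e A) =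
    (c%:E * poisson_prob Dl 0 [set m])%E.
  move=> Bm; rewrite IHS//.
  - rewrite (bigD1_seq x)//=.
    have -> : poisson_prob Dl 0 [set m] = (poi Dl (pred1 m))%:E.
      by rewrite -poi_set; congr poisson_prob; apply/seteqP; split => k /= /eqP.
    rewrite -EFinM; congr EFin; rewrite {1}/mix (negPf xS) /nx eqxx.
    rewrite (eq_bigr (fun v => poi Dl (mix (x :: S) n v))); first by rewrite /c; ring.
    by move=> v vx; rewrite /mix inE (negPf vx).
  - by move=> v vS; apply: SF; rewrite inE vS orbT.
  - move=> i v ivF vS; rewrite /nx; case: eqP => [vx|/eqP vx].
      by have [_] := fF _ _ ivF; apply; rewrite vx.
    by apply: nF => //; rewrite inE negb_or vx.
(* Partition by the value [m] of [C x]. *)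
have -> : cyl F (mix (x :: S) n) e A =
    \bigcup_(m in [set m | B x m]) cyl F (mix S (nx m)) e A.
  apply/seteqP; split => w /=.
    move=> h; exists (C x w).
      by have [] := h x xF; rewrite /mix inE eqxx.
    move=> v vF; have [+ ? ?] := h v vF; split => //.
    move: p; rewrite /mix inE /nx; case: eqP => [->|//].
    by rewrite (negPf xS) /=.
  move=> [m /= Bm h] v vF; have [p ? ?] := h v vF; split => //.
  move: p; rewrite /mix inE /nx; case: eqP => [->|//].
  by rewrite (negPf xS) /= => /eqP ->.
rewrite measure_bigcup; last 2 first.
- by move=> m _; exact: measurable_cyl.
- apply/trivIsetP => m1 m2 _ _ m12; apply/seteqP; split => // w [] /(_ x xF).
  rewrite /mix (negPf xS) /nx eqxx => -[/eqP p1 _ _] /(_ x xF).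
  by rewrite /mix (negPf xS) /nx eqxx => -[/eqP p2 _ _]; rewrite -p1 -p2 eqxx in m12.
rewrite (eq_eseriesr (g := fun m => (c%:E * poisson_prob Dl 0 [set m])%E)); last by move=> m /[!inE] Bm; exact: Em.
rewrite nneseriesZl => [|m _]; last exact: measure_ge0.
have -> : (\sum_(i <oo | i \in [set m | B x m]) poisson_prob Dl 0 [set i])%E =
    (poi Dl (B x))%:E.
  rewrite -poi_set -measure_bigcup//; first by rewrite bigcup_imset1 image_id.
  apply/trivIsetP => i j _ _ ij; apply/seteqP; split => // w [/= -> ji].
  by rewrite ji eqxx in ij.
rewrite -EFinM; congr EFin; rewrite [in RHS](bigD1_seq x)//=.
by rewrite /c {2}/mix inE eqxx; ring.
Qed.

End cylinders.

Arguments feature_prob {R d} Pp Pm b.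
Arguments cyl {R d dO Omega P} C y X F B e A.

(** * Correlations of labels on finite subtrees *)

Lemma bmeas_comp {R : realType} {d1 d2 : measure_display}
    {T1 : measurableType d1} {T2 : measurableType d2} (f : T2 -> R) (u : T1 -> T2) :
  bmeas f -> measurable_fun setT u -> bmeas (fun x => f (u x)).
Proof.
move=> [mf [K fK]] mu; split; first exact: measurableT_comp.
by exists K => x; exact: fK.
Qed.

Lemma bmeas_pred {R : realType} {d1 : measure_display} {T : measurableType d1}
    (u : T -> bool) : measurable_fun setT u -> bmeas (fun x => (u x)%:R : R).
Proof.
apply: (@bmeas_comp _ _ _ _ _ (fun b : bool => b%:R : R)); split => //.
by exists 1 => -[] /=; rewrite ?normr1 ?normr0.
Qed.

Definition offspring_ev {R : realType} {dO : measure_display} {Omega : measurableType dO}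
    {P : probability Omega R} (C : seq nat -> {RV P >-> nat})
    (F : seq (seq nat)) (B : seq nat -> pred nat) (w : Omega) : bool :=
  all (fun v => B v (C v w)) F.

Definition labels_ev {R : realType} {dO : measure_display} {Omega : measurableType dO}
    {P : probability Omega R} (y : seq nat -> {RV P >-> bool})
    (F : seq (seq nat)) (e : seq nat -> bool) (w : Omega) : bool :=
  all (fun v => y v w == e v) F.

Definition offspring_weight {R : realType} (r : R) (F : seq (seq nat))
  (B : seq nat -> pred nat) : R := \prod_(v <- F) poi r (B v).

Definition subtree_closed (F : seq (seq nat)) : Prop :=
  [/\ uniq F, [::] \in F & forall i v, i :: v \in F -> v \in F].

Definition forcing (F : seq (seq nat)) (B : seq nat -> pred nat) : Prop :=
  forall i v n, i :: v \in F -> B v n -> (i < n)%N.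

Lemma forcedP F B : subtree_closed F -> forcing F B -> forced F B.
Proof.
by move=> [uF rF cF] fB; split => // i v ivF; split; [exact: cF ivF|move=> n; exact: fB].
Qed.

Section correlations.
Context {R : realType} {d : nat} {dO : measure_display}
  {Omega : measurableType dO} {P : probability Omega R} {Dl g : R}
  {Pp Pm : probability (Rd R d) R}
  {C : seq nat -> {RV P >-> nat}} {y : seq nat -> {RV P >-> bool}}
  {X : seq nat -> {RV P >-> Rd R d}}.
Hypothesis lim : limit_object Dl g Pp Pm C y X.
Hypothesis Dl_gt0 : 0 < Dl.
Implicit Types (F S : seq (seq nat)) (B : seq nat -> pred nat)
  (e : seq nat -> bool) (A : seq nat -> set (Rd R d)) (v : seq nat).

Local Notation EP := (Ex P).
Local Notation evC := (offspring_ev C).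
Local Notation evL := (labels_ev y).
Local Notation weight := (offspring_weight Dl).

Lemma bmeas_offspring (p : pred nat) v : bmeas (fun w => (p (C v w))%:R : R).
Proof. by apply: bmeas_pred; apply: measurableT_comp. Qed.

Lemma bmeas_lab (f : bool -> R) v : bmeas (fun w => f (y v w)).
Proof.
apply: bmeas_comp => //; split => //.
exists (`|f true| + `|f false|) => -[].
  by rewrite lerDl.
by rewrite lerDr.
Qed.

Lemma bmeas_feature (f : Rd R d -> R) v : bmeas f -> bmeas (fun w => f (X v w)).
Proof. by move=> bf; apply: bmeas_comp. Qed.

Lemma bmeas_all (p : seq nat -> Omega -> bool) F :
  (forall v, bmeas (fun w => (p v w)%:R : R)) ->
  bmeas (fun w => (all (p^~ w) F)%:R : R).
Proof.
move=> bp; elim: F => [|v F IHF] /=; first exact: bmeas_cst.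
by under eq_fun do rewrite -mulnb natrM; exact: bmeasM.
Qed.

Lemma bmeas_evC F B : bmeas (fun w => (evC F B w)%:R : R).
Proof. by apply: bmeas_all => v; exact: bmeas_offspring. Qed.

Lemma bmeas_evL F e : bmeas (fun w => (evL F e w)%:R : R).
Proof.
by apply: bmeas_all => v; exact: (bmeas_lab (fun b => (b == e v)%:R)).
Qed.

(** Total probability over the labels on [F], decomposed one vertex at a time. Only the values of
    [e] on [F] matter. *)
Lemma Ex_split_labels F (f h : Omega -> R) : uniq F -> bmeas f -> bmeas h ->
  (forall e, EP (fun w => f w * (evL F e w)%:R) = EP (fun w => h w * (evL F e w)%:R)) ->
  EP f = EP h.
Proof.
elim: F f h => [|v F IHF] f h /=.
  move=> _ _ _ /(_ xpredT); rewrite /labels_ev /=.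
  by under eq_fun do rewrite mulr1; under [in RHS]eq_fun do rewrite mulr1.
move=> /andP[vF uF] bf bh fh.
have half b : EP (fun w => f w * (y v w == b)%:R) = EP (fun w => h w * (y v w == b)%:R).
  have bb := bmeas_lab (fun b' => (b' == b)%:R) v.
  apply: IHF => //; try exact: bmeasM.
  move=> e; pose e' u := if u == v then b else e u.
  have E w : (y v w == b)%:R * (evL F e w)%:R = (evL (v :: F) e' w)%:R :> R.
    rewrite -natrM mulnb /labels_ev /= {1}/e' eqxx; congr (_ && _)%:R.
    apply: eq_in_all => u uF'; rewrite /e'; case: (u =P v) => [uv|//].
    by rewrite -uv uF' in vF.
  have E' (k : Omega -> R) : (fun w => k w * (y v w == b)%:R * (evL F e w)%:R) =
      (fun w => k w * (evL (v :: F) e' w)%:R).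
    by apply/funext => w; rewrite -mulrA E.
  by rewrite !E'; exact: fh.
have whole (k : Omega -> R) : bmeas k ->
    EP k = EP (fun w => k w * (y v w == true)%:R) + EP (fun w => k w * (y v w == false)%:R).
  move=> bk; rewrite -ExD; try by apply: bmeasM => //; exact: (bmeas_lab (fun b => (b == _)%:R)).
  by congr Ex; apply/funext => w; rewrite -mulrDr; case: (y v w); rewrite /= ?(addr0, add0r) mulr1.
by rewrite whole// !half -whole.
Qed.

Lemma Ex_cyl F B e A : forced F B -> (forall v, measurable (A v)) ->
  EP \1_(cyl C y X F B e A) =
  weight F B * (\prod_(v <- F) flip_prob g e v)
    * \prod_(v <- F) fine (feature_prob Pp Pm (e v) (A v)).
Proof.
move=> fB mA; rewrite Ex_indic; last exact: measurable_cyl.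
by rewrite (cyl_prob lim).
Qed.

Lemma evCL_cyl F B e :
  (fun w => (evC F B w)%:R * (evL F e w)%:R) =
  \1_(cyl C y X F B e (fun=> setT)) :> (Omega -> R).
Proof.
apply/funext => w; rewrite indicE -natrM mulnb; congr (nat_of_bool _)%:R.
apply/andP/idP => [[/allP c /allP l]|].
  by rewrite inE => v vF; split=> //; [exact: c|exact/eqP/l].
by rewrite inE => h; split; apply/allP => v /h[? /eqP].
Qed.

Lemma Ex_evCL F B e : forced F B ->
  EP (fun w => (evC F B w)%:R * (evL F e w)%:R) =
  weight F B * \prod_(v <- F) flip_prob g e v.
Proof.
move=> fB; rewrite evCL_cyl Ex_cyl// [X in _ * X]big1 ?mulr1// => v _.
by rewrite probability_setT.
Qed.

Definition flip (g : R) (b b' : bool) : R := if b == b' then (1 + g) / 2 else (1 - g) / 2.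

(** The new label takes two values, so the left side combines two cylinder probabilities on the
    enlarged subtree. Each differs from the one on [F] by a Poisson factor and a flip
    probability. *)
Lemma Ex_fresh F B e (psi : bool -> R) i x : subtree_closed F -> x \in F ->
  i :: x \notin F -> forcing ((i :: x) :: F) B ->
  EP (fun w => (evC ((i :: x) :: F) B w)%:R * psi (y (i :: x) w) * (evL F e w)%:R) =
  poi Dl (B (i :: x)) * (psi true * flip g true (e x) + psi false * flip g false (e x))
  * EP (fun w => (evC F B w)%:R * (evL F e w)%:R).
Proof.
move=> cF xF ixF fB; have [uF rF pF] := cF; set z := i :: x; set F' := z :: F.
have cF' : subtree_closed F'.
  split => /=; first by rewrite ixF.
    by rewrite inE rF orbT.
  move=> j v; rewrite !inE => /orP[/eqP[_ ->]|/pF ->]; last exact: orbT.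
  by rewrite xF orbT.
have fF : forcing F B by move=> j v n jv; apply: fB; rewrite inE jv orbT.
pose e' b u := if u == z then b else e u.
have E w : (evC F' B w)%:R * psi (y z w) * (evL F e w)%:R =
    psi true * ((evC F' B w)%:R * (evL F' (e' true) w)%:R) +
    psi false * ((evC F' B w)%:R * (evL F' (e' false) w)%:R).
  have E' b : (evL F' (e' b) w)%:R = (y z w == b)%:R * (evL F e w)%:R :> R.
    rewrite -natrM mulnb /labels_ev /= {1}/e' eqxx; congr (_ && _)%:R.
    apply: eq_in_all => u uF'; rewrite /e'; case: (u =P z) => [uz|//].
    by move: ixF; rewrite -/z -uz uF'.
  by rewrite !E'; case: (y z w) => /=; ring.
under eq_fun do rewrite E.
have bb b : bmeas (fun w => (evC F' B w)%:R * (evL F' (e' b) w)%:R : R).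
  exact: bmeasM (bmeas_evC F' B) (bmeas_evL F' (e' b)).
rewrite ExD ?ExZ//; try exact: bmeasZ.
rewrite !Ex_evCL; try exact: forcedP.
rewrite /offspring_weight !big_cons.
have flipF b : \prod_(v <- F) flip_prob g (e' b) v = \prod_(v <- F) flip_prob g e v.
  rewrite !big_seq; apply: eq_bigr => v vF.
  have e'E u : u \in F -> e' b u = e u.
    by move=> uF'; rewrite /e'; case: (u =P z) => // uz; move: ixF; rewrite -/z -uz uF'.
  by case: v vF => [//|j u] vF /=; rewrite !e'E// (pF _ _ vF).
have flipz b : flip_prob g (e' b) z = flip g b (e x).
  rewrite /= /e' eqxx (_ : (x == z) = false)//.
  by apply/eqP => /(congr1 size) /= /n_Sn.
by rewrite !flipF !flipz; ring.
Qed.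

Definition label_at v w : R := label (y v w).

Lemma bmeas_label_at v : bmeas (label_at v).
Proof. exact: (bmeas_lab (@label R)). Qed.

Lemma label_at_evL F e v w : v \in F ->
  label_at v w * (evL F e w)%:R = label (e v) * (evL F e w)%:R.
Proof.
move=> vF; case: (boolP (evL F e w)) => [/allP/(_ v vF)/eqP|_]; last by rewrite !mulr0.
by rewrite /label_at => ->.
Qed.

(** Quantifying over every [B] separates labels from offspring: [k] does not change when further
    children are demanded, which lets [F] grow by induction. *)
Definition label_corr F s t (k : R) : Prop := forall B, forcing F B ->
  EP (fun w => (evC F B w)%:R * (label_at s w * label_at t w)) = weight F B * k.

Lemma corr_sym F s t k : label_corr F s t k -> label_corr F t s k.
Proof.
by move=> c B /c <-; congr Ex; apply/funext => w; rewrite [label_at t w * _]mulrC.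
Qed.

(** Given the labels on [F], the mean of the new label is [(1 + g) / 2 - (1 - g) / 2 = g] times the
    label of its parent. *)
Lemma corr_child F i x t k : subtree_closed F -> x \in F -> t \in F ->
  i :: x \notin F -> label_corr F x t k -> label_corr ((i :: x) :: F) (i :: x) t (g * k).
Proof.
move=> cF xF tF ixF c B fB.
have fF : forcing F B by move=> j v n jv; apply: fB; rewrite inE jv orbT.
have bC F' := bmeas_evC F' B.
have bss s u := bmeasM (bmeas_label_at s) (bmeas_label_at u).
transitivity (EP (fun w => (poi Dl (B (i :: x)) * g) *
    ((evC F B w)%:R * (label_at x w * label_at t w)))); last first.
  rewrite ExZ; last exact: bmeasM.
  by rewrite c// /offspring_weight big_cons; ring.
have [uF _ _] := cF.
apply: (Ex_split_labels uF); [exact: bmeasM|exact/bmeasZ/bmeasM|move=> e].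
transitivity (label (e t) * EP (fun w =>
    (evC ((i :: x) :: F) B w)%:R * label (y (i :: x) w) * (evL F e w)%:R)).
  rewrite -ExZ; last first.
    by apply: bmeasM; [apply: bmeasM => //; exact: bmeas_label_at|exact: bmeas_evL].
  congr Ex; apply/funext => w; rewrite mulrA -[LHS]mulrA label_at_evL// /label_at.
  by ring.
rewrite Ex_fresh//.
transitivity (poi Dl (B (i :: x)) * g * label (e x) * label (e t) *
    EP (fun w => (evC F B w)%:R * (evL F e w)%:R)).
  by rewrite /flip; case: (e x) => /=; field.
rewrite -ExZ; last by apply: bmeasM => //; exact: bmeas_evL.
congr Ex; apply/funext => w.
transitivity (poi Dl (B (i :: x)) * g * (evC F B w)%:R * (label_at x w * (label_at t w * (evL F e w)%:R))).
  rewrite label_at_evL// [label_at x w * _]mulrCA label_at_evL//; ring.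
by ring.
Qed.

(** The two flip probabilities at the new vertex sum to 1, so its label integrates out and only its
    Poisson factor remains, which belongs to the weight. *)
Lemma corr_keep F i x s t k : subtree_closed F -> x \in F -> s \in F -> t \in F ->
  i :: x \notin F -> label_corr F s t k -> label_corr ((i :: x) :: F) s t k.
Proof.
move=> cF xF sF tF ixF c B fB.
have fF : forcing F B by move=> j v n jv; apply: fB; rewrite inE jv orbT.
have bC F' := bmeas_evC F' B.
have bss s u := bmeasM (bmeas_label_at s) (bmeas_label_at u).
transitivity (EP (fun w => poi Dl (B (i :: x)) *
    ((evC F B w)%:R * (label_at s w * label_at t w)))); last first.
  rewrite ExZ; last exact: bmeasM.
  by rewrite c// /offspring_weight big_cons; ring.
have [uF _ _] := cF.
apply: (Ex_split_labels uF); [exact: bmeasM|exact/bmeasZ/bmeasM|move=> e].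
transitivity (label (e s) * label (e t) * EP (fun w =>
    (evC ((i :: x) :: F) B w)%:R * (fun=> 1) (y (i :: x) w) * (evL F e w)%:R)).
  rewrite -ExZ; last first.
    apply: bmeasM; [apply: bmeasM => //; exact: (bmeas_lab (fun=> 1))|exact: bmeas_evL].
  congr Ex; apply/funext => w.
  transitivity ((evC ((i :: x) :: F) B w)%:R * (label_at s w * (label_at t w * (evL F e w)%:R))).
    by ring.
  by rewrite label_at_evL// [label_at s w * _]mulrCA label_at_evL//; ring.
rewrite (Ex_fresh _ (fun=> 1))//.
transitivity (poi Dl (B (i :: x)) * label (e s) * label (e t) *
    EP (fun w => (evC F B w)%:R * (evL F e w)%:R)).
  by rewrite /flip; case: (e x) => /=; field.
rewrite -ExZ; last by apply: bmeasM => //; exact: bmeas_evL.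
congr Ex; apply/funext => w.
transitivity (poi Dl (B (i :: x)) * (evC F B w)%:R * (label_at s w * (label_at t w * (evL F e w)%:R))).
  by rewrite label_at_evL// [label_at s w * _]mulrCA label_at_evL//; ring.
by ring.
Qed.

End correlations.

(** * Moments of labels and features at one or two vertices *)

Section tree_moments.
Context {R : realType} {d : nat} {dO : measure_display}
  {Omega : measurableType dO} {P : probability Omega R} {Dl g : R}
  {Pp Pm : probability (Rd R d) R}
  {C : seq nat -> {RV P >-> nat}} {y : seq nat -> {RV P >-> bool}}
  {X : seq nat -> {RV P >-> Rd R d}}.
Hypothesis lim : limit_object Dl g Pp Pm C y X.
Hypothesis Dl_gt0 : 0 < Dl.
Implicit Types (F S : seq (seq nat)) (B : seq nat -> pred nat)
  (e : seq nat -> bool) (A : seq nat -> set (Rd R d)) (u v x : seq nat).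

Local Notation EP := (Ex P).
Local Notation evC := (offspring_ev C).
Local Notation evL := (labels_ev y).
Local Notation weight := (offspring_weight Dl).
Local Notation sg := (label_at (y := y)).
Local Notation corr := (label_corr (Dl := Dl) (C := C) (y := y)).
Local Notation Q := (feature_prob Pp Pm).

Lemma bmeas_evCL F B e : bmeas (fun w => (evC F B w)%:R * (evL F e w)%:R : R).
Proof. exact: bmeasM (bmeas_evC F B) (bmeas_evL F e). Qed.

(** Both sides are bilinear in [f] and [h], and [feature_law] settles indicators. The reduction to
    indicators is made in [h] with [f] fixed, then in [f]. *)
Lemma Ex_features F B e u v (f h : Rd R d -> R) : subtree_closed F -> forcing F B ->
  u \in F -> v \in F -> u != v -> bmeas f -> bmeas h ->
  EP (fun w => (evC F B w)%:R * (evL F e w)%:R * (f (X u w) * h (X v w))) =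
  EP (fun w => (evC F B w)%:R * (evL F e w)%:R) *
  (Ex (Q (e u)) f * Ex (Q (e v)) h).
Proof.
move=> cF fB uF vF uv bf bh; set c := EP (fun w => (evC F B w)%:R * (evL F e w)%:R).
have [uniqF _ _] := cF.
have evCL01 w : `|(evC F B w)%:R * (evL F e w)%:R| <= 1 :> R.
  by case: (evC F B w); case: (evL F e w);
    rewrite ?(mulr1, mulr0, mul0r, mul1r, normr1, normr0).
have bE : bmeas (fun w => (evC F B w)%:R * (evL F e w)%:R : R) by exact: bmeas_evCL.
have bEX (k k' : Rd R d -> R) : bmeas k -> bmeas k' ->
    bmeas (fun w => (evC F B w)%:R * (evL F e w)%:R * (k (X u w) * k' (X v w))).
  move=> bk bk'; apply: bmeasM => //.
  exact: bmeasM (bmeas_feature (X := X) u bk) (bmeas_feature (X := X) v bk').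
have c1 : `|c| <= 1 by exact: Ex_bound.
have bound (k k' : Rd R d -> R) K K' : bmeas k -> bmeas k' -> (forall z, `|k z| <= K) ->
    (forall z, `|k' z| <= K') ->
    `|EP (fun w => (evC F B w)%:R * (evL F e w)%:R * (k (X u w) * k' (X v w))) -
      c * (Ex (Q (e u)) k * Ex (Q (e v)) k')| <= 2 * K * K'.
  move=> bk bk' kK kK'; apply: le_trans (ler_normB _ _) _.
  rewrite -mulrA mulrDl mul1r; apply: lerD.
    apply: Ex_bound => [|w]; first exact: bEX.
    rewrite normrM -[K * K']mul1r; apply: ler_pM => //.
    by rewrite normrM; apply: ler_pM.
  rewrite normrM -[K * K']mul1r; apply: ler_pM => //.
  by rewrite normrM; apply: ler_pM => //; exact: Ex_bound.
have additive2 (k k1 k2 : Rd R d -> R) : bmeas k -> bmeas k1 -> bmeas k2 ->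
    EP (fun w => (evC F B w)%:R * (evL F e w)%:R * (k (X u w) * (k1 (X v w) + k2 (X v w)))) -
      c * (Ex (Q (e u)) k * Ex (Q (e v)) (fun z => k1 z + k2 z)) =
    (EP (fun w => (evC F B w)%:R * (evL F e w)%:R * (k (X u w) * k1 (X v w))) -
      c * (Ex (Q (e u)) k * Ex (Q (e v)) k1)) +
    (EP (fun w => (evC F B w)%:R * (evL F e w)%:R * (k (X u w) * k2 (X v w))) -
      c * (Ex (Q (e u)) k * Ex (Q (e v)) k2)).
  move=> bk bk1 bk2; rewrite ExD//; under eq_fun do rewrite !mulrDr.
  by rewrite ExD; [ring|exact: bEX|exact: bEX].
have additive1 (k k1 k2 : Rd R d -> R) : bmeas k -> bmeas k1 -> bmeas k2 ->
    EP (fun w => (evC F B w)%:R * (evL F e w)%:R * ((k1 (X u w) + k2 (X u w)) * k (X v w))) -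
      c * (Ex (Q (e u)) (fun z => k1 z + k2 z) * Ex (Q (e v)) k) =
    (EP (fun w => (evC F B w)%:R * (evL F e w)%:R * (k1 (X u w) * k (X v w))) -
      c * (Ex (Q (e u)) k1 * Ex (Q (e v)) k)) +
    (EP (fun w => (evC F B w)%:R * (evL F e w)%:R * (k2 (X u w) * k (X v w))) -
      c * (Ex (Q (e u)) k2 * Ex (Q (e v)) k)).
  move=> bk bk1 bk2; rewrite ExD//; under eq_fun do rewrite mulrDl mulrDr.
  by rewrite ExD; [ring|exact: bEX|exact: bEX].
have scale2 r (k k1 : Rd R d -> R) : bmeas k -> bmeas k1 ->
    EP (fun w => (evC F B w)%:R * (evL F e w)%:R * (k (X u w) * (r * k1 (X v w)))) -
      c * (Ex (Q (e u)) k * Ex (Q (e v)) (fun z => r * k1 z)) =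
    r * (EP (fun w => (evC F B w)%:R * (evL F e w)%:R * (k (X u w) * k1 (X v w))) -
      c * (Ex (Q (e u)) k * Ex (Q (e v)) k1)).
  move=> bk bk1; rewrite ExZ// mulrBr -[r * EP _]ExZ; last exact: bEX.
  congr (_ - _); last by ring.
  by congr Ex; apply/funext => w; ring.
have scale1 r (k k1 : Rd R d -> R) : bmeas k -> bmeas k1 ->
    EP (fun w => (evC F B w)%:R * (evL F e w)%:R * (r * k1 (X u w) * k (X v w))) -
      c * (Ex (Q (e u)) (fun z => r * k1 z) * Ex (Q (e v)) k) =
    r * (EP (fun w => (evC F B w)%:R * (evL F e w)%:R * (k1 (X u w) * k (X v w))) -
      c * (Ex (Q (e u)) k1 * Ex (Q (e v)) k)).
  move=> bk bk1; rewrite ExZ// mulrBr -[r * EP _]ExZ; last exact: bEX.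
  congr (_ - _); last by ring.
  by congr Ex; apply/funext => w; ring.
apply/eqP; rewrite -subr_eq0; apply/eqP.
have [_ [Kf fK]] := bf.
apply: (bmeas_functional_eq0 (Phi := fun h => EP (fun w =>
   (evC F B w)%:R * (evL F e w)%:R * (f (X u w) * h (X v w))) -
   c * (Ex (Q (e u)) f * Ex (Q (e v)) h)) (L := 2 * Kf)) => //.
- by move=> k1 k2 b1 b2; exact: additive2.
- by move=> r k b; exact: scale2.
- by move=> k K b kK; exact: bound.
move=> A' mA'; have bA' := bmeas_indic mA'.
apply: (bmeas_functional_eq0 (Phi := fun f => EP (fun w =>
   (evC F B w)%:R * (evL F e w)%:R * (f (X u w) * \1_A' (X v w))) -
   c * (Ex (Q (e u)) f * Ex (Q (e v)) \1_A')) (L := 2)) => //.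
- by move=> k1 k2 b1 b2; exact: additive1.
- by move=> r k b; exact: scale1.
- move=> k K b kK; rewrite -[2 * K]mulr1; apply: bound => // z.
  by rewrite indicE; case: (_ \in _); rewrite ?normr1 ?normr0.
(* Vertices other than [u] and [v] receive the whole space and contribute a factor 1. *)
move=> A mA; pose AA x := if x == u then A else if x == v then A' else setT.
have mAA x : measurable (AA x) by rewrite /AA; case: ifP => // _; case: ifP.
have AAu : AA u = A by rewrite /AA eqxx.
have AAv : AA v = A' by rewrite /AA eq_sym (negPf uv) eqxx.
apply/eqP; rewrite subr_eq0; apply/eqP.
rewrite !Ex_indic//.
transitivity (EP \1_(cyl C y X F B e AA)).
  congr Ex; apply/funext => w.
  have -> : (evC F B w)%:R * (evL F e w)%:R = \1_(cyl C y X F B e (fun=> setT)) w :> R.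
    have := evCL_cyl (C := C) (y := y) (X := X) F B e.
    by move=> /(congr1 (fun k => k w)).
  rewrite !indicE -!natrM !mulnb.
  congr (nat_of_bool _)%:R; apply/idP/idP.
    move=> /andP[/set_mem H /andP[/set_mem hu /set_mem hv]]; apply/mem_set => x xF.
    have [? ? _] := H x xF; split => //; rewrite /AA.
    by case: eqP => [->//|_]; case: eqP => [->|].
  move=> /set_mem H; apply/andP; split.
    by apply/mem_set => x xF; have [? ?] := H x xF.
  by apply/andP; split; apply/mem_set;
    [have [_ _] := H u uF; rewrite AAu|have [_ _] := H v vF; rewrite AAv].
have fF := forcedP cF fB.
rewrite (Ex_cyl lim)// /c (Ex_evCL lim)//; congr (_ * _).
rewrite (bigD1_seq u)//= AAu -big_filter (bigD1_seq v) ?filter_uniq//=; last first.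
  by rewrite mem_filter eq_sym uv vF.
rewrite AAv [X in _ * (_ * X)]big1_seq ?mulr1// => x.
rewrite mem_filter => /and3P[xv xu _].
by rewrite /AA (negPf xv) (negPf xu) probability_setT.
Qed.

Definition tail_prob (i : nat) : R := poi Dl (fun n => (i < n)%N).

(** The letters of [u] are the child indices along its path to the root, and the offspring numbers
    of its proper ancestors are independent: this is the probability that [u] is in the tree. *)
Definition path_prob u : R := \prod_(i <- u) tail_prob i.

Lemma eq_poi (p1 p2 : pred nat) : p1 =1 p2 -> poi Dl p1 = poi Dl p2.
Proof. by move=> /funext ->. Qed.

Lemma evC_const F B w : (forall v, B v =1 predT) -> evC F B w.
Proof. by move=> BT; apply/allP => v _; rewrite BT. Qed.

(* [B] asks exactly for the offspring that puts [F] in the tree. *)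
Definition carves F B : Prop :=
  [/\ subtree_closed F, forcing F B &
      forall v, (forall i, i :: v \notin F) -> B v =1 predT].

Definition require B x i : seq nat -> pred nat :=
  fun v => if v == x then fun n => B x n && (i < n)%N else B v.

Lemma carves_child F B i x : carves F B -> x \in F -> i :: x \notin F ->
  carves ((i :: x) :: F) (require B x i).
Proof.
move=> [[uF rF cF] fB lB] xF ixF; split.
- split => /=; first by rewrite ixF.
    by rewrite inE rF orbT.
  by move=> j v; rewrite !inE => /orP[/eqP[_ ->]|/cF ->]; rewrite ?xF orbT.
- move=> j v n; rewrite inE /require => /orP[/eqP[-> ->]|jvF].
    by rewrite eqxx => /andP[].
  case: eqP => [vx|_]; last exact: fB.
  by rewrite -vx => /andP[+ _]; exact: fB.
- move=> v vF n; rewrite /require; case: eqP => [vx|_].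
    by have := vF i; rewrite vx inE eqxx.
  by apply: lB => j; have := vF j; rewrite inE negb_or => /andP[].
Qed.

Lemma carves_fresh F B i x : carves F B -> i :: x \notin F ->
  B (i :: x) =1 predT.
Proof.
move=> [[_ _ cF] _ lB] ixF; apply: lB => j; apply/negP => /cF.
by rewrite (negPf ixF).
Qed.

Lemma evC_child F B i x w : carves F B -> x \in F -> i :: x \notin F ->
  evC ((i :: x) :: F) (require B x i) w = evC F B w && (i < C x w)%N.
Proof.
move=> cB xF ixF; rewrite /offspring_ev /=.
have -> : require B x i (i :: x) (C (i :: x) w).
  rewrite /require; case: eqP => [/(congr1 size)/esym/n_Sn//|_].
  by rewrite (carves_fresh cB ixF).
apply/allP/andP => [H|[/allP H iC] v vF].
  split; last by have := H x xF; rewrite /require eqxx => /andP[].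
  apply/allP => v vF; have := H v vF; rewrite /require.
  by case: eqP => // -> /andP[].
rewrite /require; case: eqP => [vx|_]; last exact: H.
by rewrite -vx H//= vx.
Qed.

Lemma weight_child F B i x : carves F B -> x \in F -> i :: x \notin F ->
  weight ((i :: x) :: F) (require B x i) =
  poi Dl (fun n => B x n && (i < n)%N) * \prod_(v <- F | v != x) poi Dl (B v).
Proof.
move=> cB xF ixF; have [[uF _ _] _ _] := cB.
rewrite /offspring_weight big_cons (bigD1_seq x)//= {1 2}/require eqxx.
rewrite (_ : (i :: x == x) = false); last first.
  by apply/eqP => /(congr1 size)/esym/n_Sn.
rewrite (eq_poi (carves_fresh cB ixF)) poi_predT// mul1r; congr (_ * _).
by apply: eq_bigr => v vx; rewrite /require (negPf vx).
Qed.

Lemma weight_child_leaf F B i x : carves F B -> x \in F ->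
  (forall j, j :: x \notin F) ->
  weight ((i :: x) :: F) (require B x i) = tail_prob i * weight F B.
Proof.
move=> cB xF lx; have [[uF _ _] _ lB] := cB.
rewrite weight_child// /offspring_weight [in RHS](bigD1_seq x)//=.
rewrite (eq_poi (lB x lx)) poi_predT// mul1r; congr (_ * _).
by apply: eq_poi => n; rewrite lB.
Qed.

Lemma corr_diag F s t : corr F s s 1 -> corr F t t 1.
Proof.
move=> c B /c <-; congr Ex; apply/funext => w; congr (_ * _).
by rewrite /label_at; case: (y s w); case: (y t w) => /=; rewrite ?mulrNN mulr1.
Qed.

Lemma corr_root : corr [:: [::]] [::] [::] 1.
Proof.
move=> B fB; have cF : subtree_closed [:: [::]] by split.
have cB := forcedP cF fB.
have E (w : Omega) : (evC [:: [::]] B w)%:R * (sg [::] w * sg [::] w) =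
    (evC [:: [::]] B w)%:R * (evL [:: [::]] xpredT w)%:R +
    (evC [:: [::]] B w)%:R * (evL [:: [::]] xpred0 w)%:R.
  by rewrite /label_at /labels_ev /=; case: (y [::] w); rewrite /=; ring.
under eq_fun do rewrite E.
rewrite ExD; [|exact: bmeas_evCL|exact: bmeas_evCL].
rewrite !(Ex_evCL lim)// !big_seq1 /=.
by field.
Qed.

(** [F] is the path from [u] to the root, along which each edge contributes one factor [g]. The
    bound on sizes makes [u] a deepest vertex of [F], so that any child of [u] is fresh when the
    induction continues. *)
Lemma path_rep u : exists F B,
  [/\ carves F B, u \in F & forall v, v \in F -> (size v <= size u)%N] /\
  [/\ (forall w, evC F B w = in_tree (fun v => C v w) u),
      weight F B = path_prob u, corr F u u 1 & corr F u [::] (g ^+ size u)].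
Proof.
elim: u => [|i x [F [B [[cB xF sF] [eB wB c1 cg]]]]].
  exists [:: [::]], (fun=> predT); split; split.
  - by split=> //; split.
  - by rewrite inE.
  - by move=> v; rewrite inE => /eqP ->.
  - by move=> w; exact: evC_const.
  - by rewrite /offspring_weight big_seq1 /path_prob big_nil poi_predT.
  - exact: corr_root.
  - exact: corr_root.
have lx j : j :: x \notin F by apply/negP => /sF; rewrite ltnn.
have [cF _ _] := cB; have [_ rF _] := cF.
exists ((i :: x) :: F), (require B x i); split; split.
- exact: carves_child.
- by rewrite inE eqxx.
- by move=> v; rewrite inE => /orP[/eqP ->//|/sF /leqW].
- by move=> w; rewrite evC_child// eB.
- by rewrite weight_child_leaf// wB /path_prob big_cons.
- by apply: (corr_diag (s := x)); apply: (corr_keep lim Dl_gt0) => //; exact: lx.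
- by rewrite /= exprS; apply: (corr_child lim Dl_gt0) => //; exact: lx.
Qed.

(* The expectation of [y_u y_v] on the event that [u] and [v] are in the tree. *)
Fixpoint pair_corr u v : R :=
  match u, v with
  | i :: u', j :: v' => g ^+ 2 * (if u' == v' then tail_prob (maxn i j) * path_prob u'
                                 else tail_prob i * tail_prob j * pair_corr u' v')
  | _, _ => 0
  end.

Lemma pair_rep u v : size u = size v -> u != v -> exists F B k,
  [/\ carves F B, u \in F, v \in F & forall x, x \in F -> (size x <= size u)%N] /\
  [/\ (forall w, evC F B w = in_tree (fun x => C x w) u && in_tree (fun x => C x w) v),
      corr F u v k & weight F B * k = pair_corr u v].
Proof.
elim: u v => [|i u IHu] [|j v]//= [suv]; have [<-{v suv} ij|uv _] := eqVneq u v.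
  have {}ij : i != j by apply: contraNneq ij => ->.
  have [F [B [[cB xF sF] [eB wB c1 cg]]]] := path_rep u.
  have lu k : k :: u \notin F by apply/negP => /sF; rewrite ltnn.
  have [cF _ _] := cB.
  pose F2 := (i :: u) :: F; pose B2 := require B u i.
  have cB2 : carves F2 B2 by exact: carves_child.
  have [cF2 _ _] := cB2.
  have uF2 : u \in F2 by rewrite inE xF orbT.
  have juF2 : j :: u \notin F2.
    by rewrite inE negb_or lu andbT; apply: contraNneq ij => -[->].
  exists ((j :: u) :: F2), (require B2 u j), (g * (g * 1)); split; split.
  - exact: carves_child.
  - by rewrite !inE eqxx orbT.
  - by rewrite inE eqxx.
  - by move=> x; rewrite !inE => /or3P[/eqP ->//|/eqP ->//|/sF /leqW].
  - move=> w; rewrite evC_child// evC_child// eB /=.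
    by case: in_tree.
  (* The correlation of the common parent with itself is 1; each of the two new edges multiplies it
     by [g]. *)
  - apply: corr_sym; apply: (corr_child lim Dl_gt0) => //; first by rewrite inE eqxx.
    by apply: corr_sym; apply: (corr_child lim Dl_gt0).
  rewrite weight_child// big_cons.
  rewrite (_ : (i :: u == u) = false) /=; last first.
    by apply/eqP => /(congr1 size)/esym/n_Sn.
  have [_ _ lB] := cB.
  have -> : poi Dl (B2 (i :: u)) = 1.
    rewrite -(poi_predT (Dl := Dl))//; apply: eq_poi => n.
    rewrite /B2 /require; case: eqP => [/(congr1 size)/esym/n_Sn//|_].
    by rewrite (carves_fresh cB).
  have -> : \prod_(v <- F | v != u) poi Dl (B2 v) = path_prob u.
    rewrite -wB /offspring_weight; have [uF _ _] := cF.
    rewrite [RHS](bigD1_seq u)//= (eq_poi (lB u lu)) poi_predT// mul1r.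
    by apply: eq_bigr => x xu; rewrite /B2 /require (negPf xu).
  (* Siblings [i] and [j] are both present exactly when the parent has more than [maxn i j]
     children: one tail instead of a product of two. *)
  have -> : poi Dl (fun n => B2 u n && (j < n)%N) = tail_prob (maxn i j).
    by apply: eq_poi => n; rewrite /B2 /require eqxx lB//= gtn_max.
  by ring.
have [F [B [k [[cB uF vF sF] [eB ck wk]]]]] := IHu v suv uv.
have lu k' : k' :: u \notin F by apply/negP => /sF; rewrite ltnn.
have lv k' : k' :: v \notin F by apply/negP => /sF; rewrite /= suv ltnn.
have [cF _ _] := cB.
pose F2 := (i :: u) :: F; pose B2 := require B u i.
have cB2 : carves F2 B2 by exact: carves_child.
have [cF2 _ _] := cB2.
have vF2 : v \in F2 by rewrite inE vF orbT.
have lv2 k' : k' :: v \notin F2.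
  by rewrite inE negb_or lv andbT; apply: contraNneq uv => -[_ ->].
exists ((j :: v) :: F2), (require B2 v j), (g * (g * k)); split; split.
- exact: carves_child.
- by rewrite !inE eqxx orbT.
- by rewrite inE eqxx.
- move=> x; rewrite !inE => /or3P[/eqP ->|/eqP ->//|/sF /leqW//].
  by rewrite /= suv.
- move=> w; rewrite evC_child// evC_child// eB /=.
  by rewrite -!andbA; congr (_ && _); rewrite andbCA.
- apply: corr_sym; apply: (corr_child lim Dl_gt0) => //; first by rewrite inE eqxx.
  by apply: corr_sym; apply: (corr_child lim Dl_gt0).
rewrite !weight_child_leaf// -wk; by ring.
Qed.

(** Multiplying the indicator by the squared label, which is 1, turns the probability into a
    diagonal correlation. *)
Lemma Ex_in_tree u : EP (fun w => (in_tree (fun v => C v w) u)%:R) = path_prob u.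
Proof.
have [F [B [[cB xF sF] [eB wB c1 cg]]]] := path_rep u.
have [cF fB _] := cB; rewrite -wB -[RHS]mulr1 -(c1 B fB).
congr Ex; apply/funext => w; rewrite eB /label_at.
by case: (y u w) => /=; rewrite ?mulrNN !mulr1.
Qed.

Lemma bmeas_in_tree u : bmeas (fun w => (in_tree (fun v => C v w) u)%:R : R).
Proof.
have [F [B [[cB xF sF] [eB wB c1 cg]]]] := path_rep u.
by under eq_fun do rewrite -eB; exact: bmeas_evC.
Qed.

(** On each labelling of [F] the features are independent, so they may be replaced by their
    conditional means [phi] and [chi]. *)
Lemma Ex_features_odd F B u v (f h : Rd R d -> R) (phi chi : bool -> R) :
  subtree_closed F -> forcing F B ->
  u \in F -> v \in F -> u != v -> bmeas f -> bmeas h ->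
  (forall b, Ex (Q b) f = phi b) -> (forall b, Ex (Q b) h = chi b) ->
  EP (fun w => (evC F B w)%:R * (f (X u w) * h (X v w))) =
  EP (fun w => (evC F B w)%:R * (phi (y u w) * chi (y v w))).
Proof.
move=> cF fB uF vF uv bf bh Ef Eh; have [uniqF _ _] := cF.
have bX : bmeas (fun w => f (X u w) * h (X v w)).
  exact: bmeasM (bmeas_feature (X := X) u bf) (bmeas_feature (X := X) v bh).
have by' : bmeas (fun w => phi (y u w) * chi (y v w)).
  exact: bmeasM (bmeas_lab (y := y) phi u) (bmeas_lab (y := y) chi v).
apply: (Ex_split_labels (y := y) uniqF);
  try by apply: bmeasM => //; exact: bmeas_evC.
move=> e; transitivity (EP (fun w => (evC F B w)%:R * (evL F e w)%:R *
    (f (X u w) * h (X v w)))).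
  by congr Ex; apply/funext => w; ring.
rewrite Ex_features// Ef Eh mulrC -ExZ; last exact: bmeas_evCL.
congr Ex; apply/funext => w.
case: (boolP (evL F e w)) => [/allP H|_]; last by rewrite !mulr0.
by rewrite (eqP (H u uF)) (eqP (H v vF)); ring.
Qed.

Lemma Ex_pair u v (f : Rd R d -> R) (m : R) : size u = size v -> u != v ->
  bmeas f -> (forall b, Ex (Q b) f = m * label b) ->
  EP (fun w => (in_tree (fun x => C x w) u)%:R * f (X u w) *
    ((in_tree (fun x => C x w) v)%:R * f (X v w))) = m ^+ 2 * pair_corr u v.
Proof.
move=> suv uv bf Ef.
have [F [B [k [[cB uF vF sF] [eB ck wk]]]]] := pair_rep suv uv.
have [cF fB _] := cB.
transitivity (EP (fun w => (evC F B w)%:R * (f (X u w) * f (X v w)))).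
  by congr Ex; apply/funext => w; rewrite eB -mulnb natrM; ring.
rewrite (Ex_features_odd cF fB uF vF uv bf bf Ef Ef) -wk -ck// -ExZ; last first.
  by apply: bmeasM; [exact: bmeas_evC|apply: bmeasM; exact: bmeas_label_at].
by congr Ex; apply/funext => w; rewrite /label_at; ring.
Qed.

Lemma Ex_root_pair u (f : Rd R d -> R) (m : R) : u != [::] ->
  bmeas f -> (forall b, Ex (Q b) f = m * label b) ->
  EP (fun w => sg [::] w * ((in_tree (fun x => C x w) u)%:R * f (X u w))) =
  m * g ^+ size u * path_prob u.
Proof.
move=> u0 bf Ef.
have [F [B [[cB uF sF] [eB wB c1 cg]]]] := path_rep u.
have [cF fB _] := cB; have [uniqF rF _] := cF.
have b1 : bmeas (fun _ : Rd R d => 1 : R) by exact: bmeas_cst.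
transitivity (EP (fun w => m * ((evC F B w)%:R * (sg u w * sg [::] w)))); last first.
  rewrite ExZ; last by apply: bmeasM; [exact: bmeas_evC|apply: bmeasM; exact: bmeas_label_at].
  by rewrite (cg B fB) wB; ring.
have bs v : bmeas (sg v) by exact: bmeas_label_at.
have bfX : bmeas (fun w => f (X u w)) by exact: (bmeas_feature (X := X)).
have beC : bmeas (fun w => (evC F B w)%:R : R) by exact: bmeas_evC.
apply: (Ex_split_labels (y := y) uniqF).
- by apply: bmeasM => //; apply: bmeasM => //; exact: bmeas_in_tree.
- by apply: bmeasZ; apply: bmeasM => //; exact: bmeasM.
move=> e.
(* The formula for two vertices is reused with the constant function 1 at the root; [u0] makes the
   vertices distinct. *)
transitivity (label (e [::]) * EP (fun w => (evC F B w)%:R * (evL F e w)%:R *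
    (f (X u w) * (fun=> 1) (X [::] w)))).
  rewrite -ExZ; last first.
    by apply: bmeasM; [exact: bmeas_evCL|apply: bmeasM => //; exact: bmeas_cst].
  congr Ex; apply/funext => w; rewrite -eB.
  transitivity ((evC F B w)%:R * f (X u w) * (sg [::] w * (evL F e w)%:R)); first by ring.
  by rewrite label_at_evL//; ring.
rewrite (@Ex_features F B e u [::] f (fun=> 1))// Ef Ex_cst.
transitivity (m * label (e u) * label (e [::]) *
    EP (fun w => (evC F B w)%:R * (evL F e w)%:R)); first by ring.
rewrite -ExZ; last exact: bmeas_evCL.
congr Ex; apply/funext => w.
transitivity (m * (evC F B w)%:R * (sg u w * (sg [::] w * (evL F e w)%:R))); last by ring.
by rewrite label_at_evL// [sg u w * _]mulrCA label_at_evL//; ring.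
Qed.

End tree_moments.

(** * Truncated moments of the Poisson law *)

Section poisson_tails.
Context {R : realType} {Dl : R}.
Hypothesis Dl_gt0 : 0 < Dl.

Local Notation tail_prob := (tail_prob (Dl := Dl)).

(** The sum stops at [n - 1]: this is the probability of [C < n], not of [C <= n]. *)
Definition poisson_cdf (n : nat) : R := \sum_(m < n) poisson_pmf Dl m.

Lemma poiD (p1 p2 : pred nat) : (forall n, ~~ (p1 n && p2 n)) ->
  poi Dl (fun n => p1 n || p2 n) = poi Dl p1 + poi Dl p2.
Proof.
move=> dp; apply: EFin_inj; rewrite EFinD -!poi_set -measureU//.
  congr (poisson_prob _ _ _); apply/seteqP; split => n /=.
    by move=> /orP.
  by move=> [->|->]; rewrite ?orbT.
apply/seteqP; split => n //= [p1n p2n].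
by have := dp n; rewrite p1n p2n.
Qed.

Lemma poi_ltn n : poi Dl (fun k => (k < n)%N) = poisson_cdf n.
Proof.
elim: n => [|n IHn].
  rewrite /poisson_cdf big_ord0 /poi.
  by rewrite (_ : [set k | _] = set0) ?measure0//; apply/seteqP; split.
rewrite /poisson_cdf big_ord_recr /= -/(poisson_cdf n) -IHn -poi_pred1// -poiD.
  by apply: eq_poi => k /=; rewrite ltnS leq_eqVlt orbC.
by move=> k /=; apply/negP => /andP[kn /eqP kE]; rewrite kE ltnn in kn.
Qed.

Lemma tail_probE i : tail_prob i = 1 - poisson_cdf i.+1.
Proof.
apply/eqP; rewrite -subr_eq opprK -poi_ltn /tail_prob -poiD; last first.
  by move=> n; rewrite ltnS ltnNge andNb.
rewrite -(poi_predT (Dl := Dl)); apply/eqP/eq_poi => n /=.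
by rewrite ltnS; case: ltngtP.
Qed.

Lemma tail_prob_ge0 i : 0 <= tail_prob i.
Proof. exact: poi_ge0. Qed.

Lemma poisson_cdf_le1 n : poisson_cdf n <= 1.
Proof.
case: n => [|n]; first by rewrite /poisson_cdf big_ord0.
by have := tail_prob_ge0 n; rewrite tail_probE subr_ge0.
Qed.

Lemma poisson_cdf_cvg : poisson_cdf n @[n --> \oo] --> (1 : R).
Proof.
have /fine_cvgP[_] : (poisson_prob Dl 0 [set k | (k < n)%N])
    @[n --> \oo] --> (1%:E : \bar R)%E.
  rewrite -(probability_setT (poisson_prob Dl 0)).
  have -> : [set: nat] = \bigcup_n [set k | (k < n)%N].
    by apply/seteqP; split => // k _; exists k.+1 => //=.
  apply: nondecreasing_cvg_mu => //.
  move=> m n mn; apply/subsetPset => k /= /leq_trans; exact.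
apply: cvg_trans; apply: near_eq_cvg; near=> n.
by rewrite /= -poi_ltn.
Unshelve. all: by end_near. Qed.

Lemma poisson_pmfS n : n.+1%:R * poisson_pmf Dl n.+1 = Dl * poisson_pmf Dl n.
Proof.
rewrite /poisson_pmf Dl_gt0 factS natrM exprS.
have n0 : n`!%:R != 0 :> R by rewrite pnatr_eq0 -lt0n fact_gt0.
have n1 : n.+1%:R != 0 :> R by rewrite pnatr_eq0.
by field; rewrite n0 addrC natr1.
Qed.

Lemma poisson_cdfS n : poisson_cdf n.+1 = poisson_cdf n + poisson_pmf Dl n.
Proof. by rewrite /poisson_cdf big_ord_recr. Qed.

(** For [m >= n], [poisson_pmfS] bounds [n + 1] times the mass at [m + 1] by [Dl] times the mass at
    [m]. Summing over [m] compares the tails; the sum is taken over finitely many [m] before passing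
    to the limit. *)
Lemma poisson_tail_step n :
  n.+1%:R * (1 - poisson_cdf n.+1) <= Dl * (1 - poisson_cdf n).
Proof.
have H N : n.+1%:R * (poisson_cdf (N + n.+1) - poisson_cdf n.+1) <=
    Dl * (poisson_cdf (N + n) - poisson_cdf n).
  elim: N => [|N IHN]; first by rewrite !add0n !subrr !mulr0.
  rewrite !addSn [poisson_cdf (N + n.+1).+1]poisson_cdfS
    [poisson_cdf (N + n).+1]poisson_cdfS.
  have : n.+1%:R * poisson_pmf Dl (N + n.+1) <= Dl * poisson_pmf Dl (N + n).
    rewrite addnS -poisson_pmfS ler_wpM2r ?poisson_pmf_ge0// ler_nat ltnS.
    exact: leq_addl.
  by move: IHN; rewrite !mulrBr !mulrDr; lra.
have c : (n.+1%:R * (poisson_cdf (N + n.+1) - poisson_cdf n.+1) : R)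
    @[N --> \oo] --> n.+1%:R * (1 - poisson_cdf n.+1).
  apply: cvgMr; apply: cvgB; last exact: cvg_cst.
  by rewrite (cvg_shiftn n.+1 poisson_cdf); exact: poisson_cdf_cvg.
apply: (cvgr_to_le c); near=> N; apply: le_trans (H N) _.
by rewrite ler_wpM2l ?(ltW Dl_gt0)// lerD2r poisson_cdf_le1.
Unshelve. all: by end_near. Qed.

(* The mean of [min C n] for a Poisson variable [C]. *)
Definition trunc_mean (n : nat) : R := \sum_(0 <= i < n) tail_prob i.

(** The part with [C > n] contributes [n + 1] times its probability. On the rest, the size-biasing
    identity [poisson_pmfS] turns the mean of [C] into [Dl] times the probability of [C < n]. *)
Lemma trunc_meanE n : trunc_mean n.+1 =
  n.+1%:R * (1 - poisson_cdf n.+1) + Dl * poisson_cdf n.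
Proof.
rewrite /trunc_mean; elim: n => [|n IHn].
  by rewrite big_nat1 tail_probE [poisson_cdf 0]big_ord0; ring.
rewrite big_nat_recr//= IHn tail_probE; have := poisson_pmfS n.
by rewrite !poisson_cdfS -natr1 => H; lra.
Qed.

Lemma trunc_mean_ge0 n : 0 <= trunc_mean n.
Proof. by apply: sumr_ge0 => i _; exact: tail_prob_ge0. Qed.

Lemma trunc_mean_le n : trunc_mean n <= Dl.
Proof.
case: n => [|n]; first by rewrite /trunc_mean big_geq// ltW.
by rewrite trunc_meanE; have := poisson_tail_step n; rewrite mulrBr mulr1; lra.
Qed.

Lemma trunc_mean_cvg : trunc_mean n @[n --> \oo] --> Dl.
Proof.
rewrite -(cvg_shiftS trunc_mean).
apply: (@squeeze_cvgr _ _ _ _ (fun n => Dl * poisson_cdf n) (cst Dl)).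
- near=> n; rewrite /= trunc_mean_le andbT trunc_meanE lerDr.
  by rewrite mulr_ge0// subr_ge0 poisson_cdf_le1.
- by rewrite -[X in _ --> X]mulr1; apply: cvgMr; exact: poisson_cdf_cvg.
- exact: cvg_cst.
Unshelve. all: by end_near. Qed.

(* The mean of [m * (m - 1)] for [m = min C n]. *)
Definition trunc_fact2 (n : nat) : R :=
  \sum_(0 <= i < n) \sum_(0 <= j < n | i != j) tail_prob (maxn i j).

(** The new ordered pairs are the [2 n] pairs that contain [n], and their maximum is [n]. *)
Lemma trunc_fact2S n :
  trunc_fact2 n.+1 = trunc_fact2 n + 2 * n%:R * tail_prob n.
Proof.
rewrite /trunc_fact2 big_nat_recr//=.
have -> : \sum_(0 <= j < n.+1 | n != j) tail_prob (maxn n j) = n%:R * tail_prob n.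
  rewrite big_mkcond big_nat_recr//= eqxx /= addr0.
  rewrite (eq_big_nat _ _ (F2 := fun=> tail_prob n)); last first.
    by move=> j /andP[_ jn]; rewrite (gtn_eqF jn) (maxn_idPl (ltnW jn)).
  by rewrite big_const_nat subn0 iter_addr_0 mulr_natl.
rewrite (eq_big_nat _ _ (F2 := fun i =>
   \sum_(0 <= j < n | i != j) tail_prob (maxn i j) + tail_prob n)); last first.
  move=> i /andP[_ iN]; rewrite big_mkcond big_nat_recr//= -big_mkcond.
  by rewrite (ltn_eqF iN) (maxn_idPr (ltnW iN)).
rewrite big_split /= [X in _ + X + _]big_const_nat subn0 iter_addr_0 mulr_natl.
by ring.
Qed.

(** Size-biasing twice turns the factorial moment of [C] below the truncation into [Dl ^+ 2] times a
    probability with index lowered by two. *)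
Lemma trunc_fact2E n : trunc_fact2 n.+2 =
  n.+2%:R * n.+1%:R * (1 - poisson_cdf n.+2) + Dl ^+ 2 * poisson_cdf n.
Proof.
elim: n => [|n IHn].
  rewrite !trunc_fact2S /trunc_fact2 big_geq// !tail_probE.
  rewrite [poisson_cdf 0]big_ord0; ring.
rewrite trunc_fact2S IHn tail_probE.
have h1 := poisson_pmfS n; have h2 := poisson_pmfS n.+1.
have h3 : n.+2%:R * n.+1%:R * poisson_pmf Dl n.+2 = Dl ^+ 2 * poisson_pmf Dl n.
  by rewrite mulrAC h2 mulrAC -mulrA h1; ring.
rewrite [poisson_cdf n.+3]poisson_cdfS [poisson_cdf n.+1]poisson_cdfS.
rewrite [Dl ^+ 2 * (_ + _)]mulrDr -h3 -!natr1; ring.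
Qed.

Lemma trunc_fact2_le n : trunc_fact2 n <= Dl ^+ 2.
Proof.
have D0 := ltW Dl_gt0.
case: n => [|[|n]].
- by rewrite /trunc_fact2 big_geq// sqr_ge0.
- by rewrite trunc_fact2S /trunc_fact2 big_geq// mulr0 mul0r addr0 sqr_ge0.
rewrite trunc_fact2E.
have h1 := poisson_tail_step n.+1; have h2 := poisson_tail_step n.
have : n.+2%:R * n.+1%:R * (1 - poisson_cdf n.+2) <=
    Dl * (Dl * (1 - poisson_cdf n)).
  rewrite mulrAC; apply: (@le_trans _ _ (Dl * (1 - poisson_cdf n.+1) * n.+1%:R)).
    by rewrite ler_wpM2r.
  by rewrite -mulrA ler_wpM2l// mulrC.
by rewrite expr2; lra.
Qed.

End poisson_tails.

(** * Sums over words of a given length *)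

Section word_levels.
Context {R : realType} {Dl g : R}.
Hypothesis Dl_gt0 : 0 < Dl.

Local Notation tail_prob := (tail_prob (Dl := Dl)).
Local Notation path_prob := (path_prob (Dl := Dl)).
Local Notation pair_corr := (pair_corr (Dl := Dl) (g := g)).
Local Notation trunc_mean := (trunc_mean (Dl := Dl)).
Local Notation trunc_fact2 := (trunc_fact2 (Dl := Dl)).

(* The words of length [k] over the letters [0, ..., n - 1]. *)
Definition words (n k : nat) : seq (seq nat) := level (fun=> n) k.

Lemma words_uniq n k : uniq (words n k).
Proof. exact: level_uniq. Qed.

Lemma size_words n k v : v \in words n k -> size v = k.
Proof. by rewrite mem_level => /andP[_ /eqP]. Qed.

Lemma big_wordsS n k (F : seq nat -> R) :
  \sum_(v <- words n k.+1) F v = \sum_(v <- words n k) \sum_(0 <= i < n) F (i :: v).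
Proof.
rewrite /words /= big_allpairs_dep; apply: eq_bigr => v _.
by rewrite /index_iota subn0.
Qed.

Lemma path_prob_ge0 v : 0 <= path_prob v.
Proof. by apply: prodr_ge0 => i _; exact: tail_prob_ge0. Qed.

Lemma sum_path_prob n k : \sum_(v <- words n k) path_prob v = trunc_mean n ^+ k.
Proof.
elim: k => [|k IHk]; first by rewrite big_seq1 /path_prob big_nil.
rewrite big_wordsS exprSr -IHk mulr_suml; apply: eq_bigr => v _.
rewrite /trunc_mean mulr_sumr; apply: eq_bigr => i _.
by rewrite /path_prob big_cons mulrC.
Qed.

Lemma pair_corr_ge0 u v : 0 <= pair_corr u v.
Proof.
elim: u v => [|i u IHu] [|j v] //=.
apply: mulr_ge0; first exact: sqr_ge0.
by case: ifP => _; do ?apply: mulr_ge0 => //; rewrite ?tail_prob_ge0 ?path_prob_ge0.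
Qed.

Definition pair_sum (n k : nat) : R :=
  \sum_(u <- words n k) \sum_(v <- words n k | u != v) pair_corr u v.

Lemma pair_sum_ge0 n k : 0 <= pair_sum n k.
Proof. by do 2 apply: sumr_ge0 => ? _; exact: pair_corr_ge0. Qed.

(** Pairs of length [k + 1] are sorted by their parents. Equal parents leave a sum over distinct
    siblings, [trunc_fact2]; distinct parents are extended by two independent letters, each summing
    to [trunc_mean]. *)
Lemma pair_sumS n k : pair_sum n k.+1 =
  g ^+ 2 * (trunc_fact2 n * trunc_mean n ^+ k + trunc_mean n ^+ 2 * pair_sum n k).
Proof.
rewrite /pair_sum big_wordsS -sum_path_prob !mulr_sumr -big_split /= mulr_sumr.
apply: eq_big_seq => u uw.
transitivity (\sum_(v <- words n k) \sum_(0 <= i < n) \sum_(0 <= j < n)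
    if i :: u != j :: v then pair_corr (i :: u) (j :: v) else 0).
  rewrite [RHS]exchange_big /=; apply: eq_bigr => i _.
  by rewrite big_mkcond big_wordsS.
rewrite (bigD1_seq u)//= ?words_uniq// mulrDr; congr (_ + _).
  rewrite /trunc_fact2 mulr_suml mulr_sumr; apply: eq_bigr => i _.
  rewrite mulr_suml mulr_sumr [RHS]big_mkcond; apply: eq_bigr => j _.
  rewrite eqseq_cons eqxx andbT; case: ifP => // _.
rewrite !mulr_sumr [RHS]big_mkcond [LHS]big_mkcond; apply: eq_bigr => v _.
have [<-|uv] := eqVneq u v; rewrite ?eqxx//.
transitivity (\sum_(0 <= i < n) \sum_(0 <= j < n)
    g ^+ 2 * (tail_prob i * tail_prob j * pair_corr u v)).
  apply: eq_bigr => i _; apply: eq_bigr => j _.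
  by rewrite eqseq_cons /= (negPf uv) andbF.
rewrite [trunc_mean n ^+ 2]expr2 {1}/trunc_mean !mulr_suml mulr_sumr.
apply: eq_bigr => i _.
by rewrite /trunc_mean mulr_sumr mulr_suml mulr_sumr.
Qed.

(** With equality the right side solves the recursion [q_(k+1) = g^2 Dl^2 (Dl^k + q_k)], [q_0 = 0],
    satisfied in the limit of all words. The subtracted [Dl ^+ k] is what closes the induction. *)
Lemma pair_sum_le n k : 0 <= g ^+ 2 * Dl - 1 -> (g ^+ 2 * Dl - 1) * pair_sum n k <=
  g ^+ 2 * Dl * (((g * Dl) ^+ k) ^+ 2 - Dl ^+ k).
Proof.
move=> kap1; have D0 := ltW Dl_gt0; elim: k => [|k IHk].
  rewrite /pair_sum big_seq1 big_mkcond big_seq1 eqxx /=; lra.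
have step : pair_sum n k.+1 <= g ^+ 2 * (Dl ^+ 2 * Dl ^+ k + Dl ^+ 2 * pair_sum n k).
  rewrite pair_sumS; apply: ler_wpM2l; first exact: sqr_ge0.
  have m0 := trunc_mean_ge0 (Dl := Dl) n.
  have mD := trunc_mean_le Dl_gt0 n.
  apply: lerD; last by rewrite ler_wpM2r ?pair_sum_ge0// lerXn2r.
  apply: ler_pM; last by rewrite lerXn2r.
  - by do 2 apply: sumr_ge0 => ? _; exact: tail_prob_ge0.
  - exact: exprn_ge0.
  - exact: trunc_fact2_le.
apply: le_trans (ler_wpM2l kap1 step) _.
have : g ^+ 2 * Dl ^+ 2 * ((g ^+ 2 * Dl - 1) * pair_sum n k) <=
    g ^+ 2 * Dl ^+ 2 * (g ^+ 2 * Dl * (((g * Dl) ^+ k) ^+ 2 - Dl ^+ k)).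
  by apply: ler_wpM2l => //; rewrite -exprMn sqr_ge0.
rewrite !exprS; set G := (g * Dl) ^+ k; set E := Dl ^+ k; set Q := pair_sum n k.
rewrite ?expr0 ?mulr1 => H; nra.
Qed.

End word_levels.

(** * Mean and variance of a level sum *)

Section level_moments.
Context {R : realType} {d : nat} {dO : measure_display}
  {Omega : measurableType dO} {P : probability Omega R} {Dl g : R}
  {Pp Pm : probability (Rd R d) R}
  {C : seq nat -> {RV P >-> nat}} {y : seq nat -> {RV P >-> bool}}
  {X : seq nat -> {RV P >-> Rd R d}}.
Hypothesis lim : limit_object Dl g Pp Pm C y X.
Hypothesis Dl_gt0 : 0 < Dl.

Local Notation sg := (label_at (y := y)).
Local Notation Q := (feature_prob Pp Pm).
Local Notation path_prob := (path_prob (Dl := Dl)).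
Local Notation trunc_mean := (trunc_mean (Dl := Dl)).

(** The indicator is needed because features at words outside the tree have no prescribed law. *)
Definition tree_term (f : Rd R d -> R) (u : seq nat) (w : Omega) : R :=
  (in_tree (fun v => C v w) u)%:R * f (X u w).

Definition level_sum (f : Rd R d -> R) (n k : nat) (w : Omega) : R :=
  \sum_(u <- words n k) tree_term f u w.

Variables (f : Rd R d -> R) (m c : R).
Hypothesis bf : bmeas f.
Hypothesis f_mean : forall b, Ex (Q b) f = m * label b.
Hypothesis f_le : forall x, `|f x| <= c.

Lemma bmeas_tree_term u : bmeas (tree_term f u).
Proof.
exact: bmeasM (bmeas_in_tree lim Dl_gt0 u) (bmeas_feature (X := X) u bf).
Qed.

Lemma bmeas_level_sum n k : bmeas (level_sum f n k).
Proof. by apply: bmeas_sum => u; exact: bmeas_tree_term. Qed.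

Lemma Ex_level_sum n k : (0 < k)%N ->
  Ex P (fun w => sg [::] w * level_sum f n k w) = m * g ^+ k * trunc_mean n ^+ k.
Proof.
move=> k0; rewrite -sum_path_prob mulr_sumr.
under eq_fun do rewrite mulr_sumr.
rewrite Ex_sum => [|u]; last by apply: bmeasM; [exact: bmeas_label_at|exact: bmeas_tree_term].
apply: eq_big_seq => u /size_words su.
rewrite (Ex_root_pair lim Dl_gt0 _ bf f_mean) ?su//.
by apply: contraTneq k0 => u0; rewrite -su u0.
Qed.

Lemma Ex_level_sum_sqr n k :
  Ex P (fun w => level_sum f n k w ^+ 2) <=
  c ^+ 2 * trunc_mean n ^+ k + m ^+ 2 * pair_sum (Dl := Dl) (g := g) n k.
Proof.
have bt u v : bmeas (fun w => tree_term f u w * tree_term f v w).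
  by apply: bmeasM; exact: bmeas_tree_term.
have -> : (fun w => level_sum f n k w ^+ 2) = (fun w =>
    \sum_(u <- words n k) \sum_(v <- words n k) tree_term f u w * tree_term f v w).
  apply/funext => w; rewrite expr2 /level_sum mulr_suml; apply: eq_bigr => u _.
  by rewrite mulr_sumr.
rewrite Ex_sum => [|u]; last exact: bmeas_sum.
rewrite -sum_path_prob /pair_sum !mulr_sumr -big_split /=.
rewrite big_seq [leRHS]big_seq; apply: ler_sum => u uw.
rewrite Ex_sum// (bigD1_seq u)//= ?words_uniq//; apply: lerD.
  rewrite -(Ex_in_tree lim Dl_gt0) -ExZ; last exact: bmeas_in_tree lim Dl_gt0 u.
  apply: le_Ex => // [|w]; first exact: bmeasZ (bmeas_in_tree lim Dl_gt0 u).
  rewrite /tree_term; case: in_tree; rewrite ?(mul0r, mulr0)// !mul1r mulr1 -expr2.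
  by rewrite -[f _ ^+ 2]real_normK ?num_real// lerXn2r// nnegrE (le_trans _ (f_le (X u w))).
rewrite mulr_sumr big_seq_cond [leRHS]big_seq_cond.
rewrite (eq_bigl (fun v => (v \in words n k) && (u != v))); last first.
  by move=> v; rewrite eq_sym.
apply: ler_sum => v /andP[vw uv].
by rewrite (Ex_pair lim Dl_gt0 _ uv bf f_mean)// (size_words uw) (size_words vw).
Qed.

(** The squared root label is 1, so only the second moment of the level sum and its correlation with
    the root remain. The latter involves [trunc_mean n] instead of [Dl]; the last summand is this
    defect, which vanishes as [n] grows. *)
Lemma Ex_level_dev n k (w := m * (g * Dl) ^+ k) :
  (0 < k)%N -> 1 < g ^+ 2 * Dl -> 0 <= g ->
  Ex P (fun o => (sg [::] o * level_sum f n k o - w) ^+ 2) <=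
  c ^+ 2 * Dl ^+ k + w ^+ 2 / (g ^+ 2 * Dl - 1)
  + 2 * w * (w - m * (g * trunc_mean n) ^+ k).
Proof.
move=> k0 kap1 g0.
have bL := bmeas_level_sum n k.
have bsL : bmeas (fun o => sg [::] o * level_sum f n k o).
  by apply: bmeasM => //; exact: bmeas_label_at.
have -> : (fun o => (sg [::] o * level_sum f n k o - w) ^+ 2) =
   (fun o => level_sum f n k o ^+ 2 + (- (2 * w)) * (sg [::] o * level_sum f n k o) + w ^+ 2).
  apply/funext => o; rewrite /label_at; case: (y [::] o) => /=; ring.
rewrite ExD; last exact: bmeas_cst; last first.
  by apply: bmeasD; [exact: bmeas_sqr|exact: bmeasZ].
rewrite ExD; [|exact: bmeas_sqr|exact: bmeasZ].
rewrite ExZ// Ex_cst Ex_level_sum//.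
have k1 : 0 < g ^+ 2 * Dl - 1 by rewrite subr_gt0.
have D0 := ltW Dl_gt0.
(* With [kap = g ^+ 2 * Dl], this is [kap / (kap - 1) = 1 + 1 / (kap - 1)]; the leading [w ^+ 2]
   cancels when the square is expanded. *)
have qle : m ^+ 2 * pair_sum (Dl := Dl) (g := g) n k <= w ^+ 2 + w ^+ 2 / (g ^+ 2 * Dl - 1).
  have -> : w ^+ 2 + w ^+ 2 / (g ^+ 2 * Dl - 1) =
      m ^+ 2 * ((g ^+ 2 * Dl) * ((g * Dl) ^+ k) ^+ 2 / (g ^+ 2 * Dl - 1)).
    by rewrite /w; field; rewrite gt_eqF.
  apply: ler_wpM2l; first exact: sqr_ge0.
  rewrite ler_pdivlMr// mulrC; apply: le_trans (pair_sum_le Dl_gt0 n k (ltW k1)) _.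
  apply: ler_wpM2l; first by rewrite mulr_ge0// sqr_ge0.
  by rewrite gerBl exprn_ge0.
have tle : c ^+ 2 * trunc_mean n ^+ k <= c ^+ 2 * Dl ^+ k.
  apply: ler_wpM2l; first exact: sqr_ge0.
  by rewrite lerXn2r ?nnegrE ?trunc_mean_ge0 ?trunc_mean_le.
have := Ex_level_sum_sqr n k; rewrite [(g * trunc_mean n) ^+ k]exprMn.
set A := Ex P _; set B := m ^+ 2 * _ in qle *; set q := w ^+ 2 / _ in qle *.
by move=> ?; nra.
Qed.

End level_moments.

(** * Bounds on the inverse hyperbolic tangent *)

Section artanh_bounds.
Context {R : realType}.
Implicit Types u : R.

Lemma artanhN u : -1 < u < 1 -> artanh (- u) = - artanh u.
Proof.
move=> /andP[u1 u2]; rewrite /artanh opprK -mulNr; congr (_ / _).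
rewrite -lnV; last by rewrite posrE divr_gt0//; lra.
by rewrite invf_div.
Qed.

Lemma artanh_le u : 0 <= u < 1 -> artanh u <= u / (1 - u).
Proof.
move=> /andP[u0 u1]; have d0 : 0 < 1 - u by lra.
rewrite /artanh ler_pdivrMr//.
have -> : (1 + u) / (1 - u) = 1 + u / (1 - u) * 2 by field; rewrite gt_eqF.
apply: le_ln1Dx; have : 0 <= u / (1 - u) by rewrite divr_ge0// ltW.
lra.
Qed.

(** The function [2 (artanh x - x)] vanishes at 0 and has derivative [2 x^2 / (1 - x^2) >= 0]. *)
Lemma artanh_ge u : 0 <= u < 1 -> u <= artanh u.
Proof.
move=> /andP[u0 u1].
pose f x : R := ln (1 + x) - ln (1 - x) - 2 * x.
pose df x : R := (1 + x)^-1 + (1 - x)^-1 - 2.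
have fdf (x : R) : -1 < x < 1 -> is_derive x (1 : R) f (df x).
  move=> /andP[x0 x1].
  have i1 : is_derive (1 + x) (1 : R) (@ln R) (1 + x)^-1.
    by apply: is_derive1_ln; lra.
  have i2 : is_derive (1 - x) (1 : R) (@ln R) (1 - x)^-1.
    by apply: is_derive1_ln; lra.
  rewrite /f; apply: is_derive_eq.
  by rewrite /GRing.scale /= /df; ring.
have der (x : R) : x \in `]0, u[ -> is_derive x (1 : R) f (df x).
  by rewrite in_itv /= => /andP[? ?]; apply: fdf; apply/andP; split; lra.
have cont : {within `[0, u], continuous f}.
  apply: derivable_within_continuous => x; rewrite in_itv /= => /andP[? ?].
  by apply: ex_derive; apply: fdf; apply/andP; split; lra.
have [x + fE] := MVT_segment u0 der cont; rewrite in_itv /= => /andP[x0 xu].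
have f0 : f 0 = 0 by rewrite /f addr0 subr0 ln1; ring.
have : 0 <= f u.
  rewrite f0 !subr0 in fE; rewrite fE; apply: mulr_ge0 => //.
  have -> : df x = 2 * x ^+ 2 / ((1 + x) * (1 - x)).
    by rewrite /df; field; apply/andP; split; apply: lt0r_neq0; lra.
  apply: divr_ge0; first by rewrite mulr_ge0// sqr_ge0.
  by apply: mulr_ge0; lra.
rewrite /f /artanh ln_div ?posrE; [|lra|lra].
by move=> ?; rewrite ler_pdivlMr//; lra.
Qed.

Lemma artanh_abs_le u (r : R) : `|u| <= r -> r < 1 -> `|artanh u| <= `|u| / (1 - r).
Proof.
move=> ur r1; have u1 : `|u| < 1 by exact: le_lt_trans r1.
have H v : 0 <= v <= r -> `|artanh v| <= v / (1 - r).
  move=> /andP[v0 vr]; have v01 : 0 <= v < 1 by rewrite v0 (le_lt_trans vr).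
  rewrite ger0_norm; last exact: le_trans (artanh_ge v01).
  apply: le_trans (artanh_le v01) _.
  by apply: ler_wpM2l => //; rewrite lef_pV2 ?posrE; lra.
have [u0|u0] := lerP 0 u; first by rewrite !(ger0_norm u0) in ur *; apply: H; rewrite u0.
rewrite -(normrN (artanh u)) -artanhN; last by rewrite -ltr_norml.
rewrite (ltr0_norm u0) in ur; rewrite (ltr0_norm u0).
by apply: H; rewrite ur andbT; lra.
Qed.

Lemma mul_artanh_ge (v u : R) : 0 <= v -> v * `|u| < 1 ->
  v * u ^+ 2 <= u * artanh (v * u).
Proof.
move=> v0 vu1; have [u0|u0] := lerP 0 u.
  rewrite expr2 mulrCA; apply: ler_wpM2l => //; apply: artanh_ge.
  by rewrite mulr_ge0//= -{1}(ger0_norm u0).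
have {}vu1 : v * - u < 1 by rewrite -(ltr0_norm u0).
have vu0 : 0 <= v * - u by rewrite mulr_ge0// oppr_ge0 ltW.
have -> : u * artanh (v * u) = - u * artanh (v * - u).
  by rewrite mulrN artanhN; [rewrite mulrNN|apply/andP; split; lra].
have -> : v * u ^+ 2 = - u * (v * - u) by ring.
by apply: ler_wpM2l; [lra|apply: artanh_ge; rewrite vu0].
Qed.

End artanh_bounds.

Lemma measurable_fun_artanh {R : realType} {d : measure_display}
    {T : measurableType d} (u : T -> R) : (forall x, `|u x| <= 1) ->
  measurable_fun setT u -> measurable_fun setT (fun x => artanh (u x)).
Proof.
move=> u1 mu; rewrite /artanh.
(* The inverse is read as the power [-1], which is legitimate for a nonnegative base; hence the
   bound on [u]. *)
have -> : (fun x => ln ((1 + u x) / (1 - u x)) / 2) =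
    (fun x => ln ((1 + u x) * (1 - u x) `^ (-1)) * 2^-1).
  apply/funext => x; rewrite powR_inv1//.
  by have := u1 x; rewrite ler_norml => /andP[_]; rewrite subr_ge0.
have c1 : measurable_fun setT (fun _ : T => 1 : R) := measurable_cst _.
apply: measurable_funM; last exact: measurable_cst.
apply: measurableT_comp; first exact: measurable_ln.
apply: measurable_funM; first exact: measurable_funD.
apply: (measurableT_comp (f := fun z => z `^ (-1))); first exact: measurable_powR.
exact: measurable_funB.
Qed.

(** * Densities, reflection and scores *)

Section densities.
Context {R : realType} {d : nat}.
Variables (mu : {measure set (Rd R d) -> \bar R})
  (Pp Pm : probability (Rd R d) R) (rp rm : Rd R d -> R).
Hypothesis A1 : assumption1 mu Pp Pm rp rm.

Local Notation t := (tfun rp rm).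
Local Notation Q := (feature_prob Pp Pm).

Lemma density_integrable (P : probability (Rd R d) R) rho (f : Rd R d -> R) :
  density_of mu P rho -> bmeas f ->
  mu.-integrable setT (EFin \o (fun x => f x * rho x)).
Proof.
move=> [mrho rho0 Prho] [mf [K fK]].
have irho : mu.-integrable setT (EFin \o rho).
  apply/integrableP; split; first exact/measurable_EFinP.
  under eq_integral => x _ do rewrite /= ger0_norm//.
  by rewrite -Prho// (le_lt_trans (probability_le1 _ _))// ltry.
apply: (@le_integrable _ _ _ _ _ _ _ (EFin \o (fun x => K * rho x))) => //.
- by apply/measurable_EFinP; exact: measurable_funM.
- move=> x _ /=; rewrite lee_fin !normrM; apply: ler_wpM2r => //.
  by apply: le_trans (fK x) (ler_norm _).
- have := integrableZl measurableT K irho.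
  by congr (_.-integrable _ _); apply/funext => x; rewrite /= EFinM.
Qed.

Lemma Ex_density (P : probability (Rd R d) R) rho (f : Rd R d -> R) :
  density_of mu P rho -> bmeas f -> Ex P f = \int[mu]_x (f x * rho x).
Proof.
move=> dP bf; have [mrho rho0 Prho] := dP.
apply/eqP; rewrite -subr_eq0; apply/eqP.
apply: (bmeas_functional_eq0 (Phi := fun f => Ex P f - \int[mu]_x (f x * rho x))
  (L := 2)) bf.
- move=> h k bh bk; rewrite ExD//.
  under eq_Rintegral => x _ do rewrite mulrDl.
  by rewrite RintegralD//; [ring|exact: density_integrable dP bh|exact: density_integrable dP bk].
- move=> r h bh; rewrite ExZ//.
  under eq_Rintegral => x _ do rewrite -mulrA.
  by rewrite RintegralZl//; [ring|exact: density_integrable dP bh].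
- move=> h K bh hK; apply: le_trans (ler_normB _ _) _.
  rewrite mulrDl mul1r; apply: lerD; first exact: Ex_bound.
  have ih := density_integrable dP bh.
  have iK := density_integrable dP (bmeas_cst K).
  apply: le_trans (le_normr_Rintegral _ ih) _ => //.
  apply: (@le_trans _ _ (\int[mu]_x (K * rho x))).
    apply: le_Rintegral => //; first exact: integrable_norm.
    by move=> x _; rewrite normrM (ger0_norm (rho0 x)) ler_wpM2r.
  have i1 := density_integrable dP (bmeas_cst 1).
  rewrite RintegralZl//; last first.
    by move: i1; congr (_.-integrable _ (EFin \o _)); apply/funext => x; rewrite mul1r.
  by rewrite /Rintegral -Prho// probability_setT mulr1.
move=> A mA; rewrite Ex_indic// Prho// /Rintegral.
apply/eqP; rewrite subr_eq0; apply/eqP; congr fine.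
rewrite [LHS]integral_mkcond; apply: eq_integral => x _.
rewrite /= patchE indicE; case: ifP => _; by rewrite ?mul1r ?mul0r.
Qed.

Let dp : density_of mu Pp rp. Proof. by have [] := A1. Qed.
Let dm : density_of mu Pm rm. Proof. by have [] := A1. Qed.
Let rp0 x : 0 <= rp x. Proof. by have [_ + _] := dp; apply. Qed.
Let rm0 x : 0 <= rm x. Proof. by have [_ + _] := dm; apply. Qed.
Let mrp : measurable_fun setT rp. Proof. by have [] := dp. Qed.
Let mrm : measurable_fun setT rm. Proof. by have [] := dm. Qed.

Lemma tfun_le1 x : `|t x| <= 1.
Proof.
have := rp0 x; have := rm0 x; rewrite /tfun => b a.
have [s0|s0] := eqVneq (rp x + rm x) 0; first by rewrite s0 invr0 mulr0 normr0.
have s1 : 0 < rp x + rm x by rewrite lt0r s0 addr_ge0.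
rewrite normrM normfV (gtr0_norm s1) ler_pdivrMr// mul1r.
by rewrite ler_norml; apply/andP; split; lra.
Qed.

Lemma measurable_tfun : measurable_fun setT t.
Proof.
have -> : t = (fun x => (rp x - rm x) * (rp x + rm x) `^ (-1)).
  by apply/funext => x; rewrite powR_inv1// addr_ge0.
apply: measurable_funM; first exact: measurable_funB.
apply: (measurableT_comp (f := fun z => z `^ (-1))); first exact: measurable_powR.
exact: measurable_funD.
Qed.

Lemma bmeas_tfun : bmeas t.
Proof. by split; [exact: measurable_tfun|exists 1; exact: tfun_le1]. Qed.

Lemma Ex_ae_eq (P : probability (Rd R d) R) (f h : Rd R d -> R) N : bmeas f -> bmeas h ->
  measurable N -> P N = 0%E -> (forall x, ~ N x -> f x = h x) -> Ex P f = Ex P h.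
Proof.
move=> [mf _] [mh _] mN N0 fh; rewrite /Ex /Rintegral; congr fine.
apply: ae_eq_integral => //; try exact/measurable_EFinP.
exists N; split => // x /= H; apply: contrapT => /fh fhx; apply: H => _.
by rewrite fhx.
Qed.

(** The involution carries one law to the other and exchanges the densities, so [t (tau x) = - t x]
    almost everywhere. *)
Lemma Ex_reflect (phi : R -> R) : bmeas (fun x => phi (t x)) ->
  bmeas (fun x => phi (- t x)) ->
  Ex Pm (fun x => phi (t x)) = Ex Pp (fun x => phi (- t x)).
Proof.
move=> bphi bphiN; have [_ _ _ _ [tau [tauK [mtau ptau] ae]]] := A1.
have [_ _ PpE] := dp; have [_ _ PmE] := dm.
have mrpt : measurable_fun setT (fun x => rp (tau x)) by exact: measurableT_comp.
have swap A : measurable A -> Pm A = Pp (tau @^-1` A).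
  move=> mA; have mtA : measurable (tau @^-1` A).
    by rewrite -[X in measurable X]setTI; exact: mtau.
  rewrite PmE// PpE//.
  transitivity (\int[mu]_(x in A) (rp (tau x))%:E)%E.
    apply: ae_eq_integral => //; try by apply/measurable_EFinP; exact: measurable_funTS.
    move: ae => [N [mN N0 NE]]; exists N; split => // x /= H; apply: NE => /= rE.
    by apply: H => _; rewrite rE.
  (* Since [mu] is its own image under [tau], the change of variables produces
     [rp (tau (tau x)) = rp x]. *)
  transitivity (\int[pushforward mu tau]_(x in A) (rp (tau x))%:E)%E.
    by apply: eq_measure_integral => B mB _; rewrite /= /pushforward ptau.
  rewrite ge0_integral_pushforward//.
  - by apply: eq_integral => x _ /=; rewrite tauK.
  - by apply/measurable_EFinP; exact: measurable_funTS.
  - by move=> x _; rewrite lee_fin.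
have swapE (f : Rd R d -> R) : bmeas f -> Ex Pm f = Ex Pp (fun x => f (tau x)).
  move=> bf; apply/eqP; rewrite -subr_eq0; apply/eqP.
  apply: (bmeas_functional_eq0 (Phi := fun f => Ex Pm f - Ex Pp (fun x => f (tau x)))
    (L := 2)) bf.
  - move=> h k bh bk; rewrite !ExD//; [ring|exact: (bmeas_comp bh)|exact: (bmeas_comp bk)].
  - by move=> r h bh; rewrite !ExZ//; [ring|exact: (bmeas_comp bh)].
  - move=> h K bh hK; apply: le_trans (ler_normB _ _) _.
    rewrite mulrDl mul1r; apply: lerD; first exact: Ex_bound.
    by apply: Ex_bound => //; exact: (bmeas_comp bh).
  move=> A mA; rewrite Ex_indic// swap//.
  have mtA : measurable (tau @^-1` A).
    by rewrite -[X in measurable X]setTI; exact: mtau.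
  rewrite (_ : (fun x => \1_A (tau x)) = \1_(tau @^-1` A)) ?Ex_indic ?subrr//.
rewrite swapE//; have [N [mN N0 NE]] := ae.
have mtN : measurable (tau @^-1` N).
  by rewrite -[X in measurable X]setTI; exact: mtau.
have Pp0 B : measurable B -> mu B = 0%E -> Pp B = 0%E.
  move=> mB B0; rewrite PpE// null_set_integral//.
  by apply/measurable_EFinP; exact: measurable_funTS.
(* The relation between the densities is used both at [x] and at [tau x], so both must avoid the
   exceptional set. *)
apply: (@Ex_ae_eq _ _ _ (N `|` tau @^-1` N)) => //.
- exact: (bmeas_comp bphi).
- exact: measurableU.
- by apply: null_set_setU => //; apply: Pp0 => //; rewrite ptau.
move=> x /not_orP[xN txN]; congr phi.
have rE z : ~ N z -> rm z = rp (tau z).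
  by move=> zN; apply: contrapT => H; exact/zN/NE.
by rewrite /tfun (rE _ txN) tauK -(rE _ xN) [rm x + rp x]addrC -mulNr opprB.
Qed.

(** Against [mu], both integrands equal [2 rp rm / (rp + rm)] times [f], and both are 0 where the
    two densities vanish. *)
Lemma Ex_tilt (f : Rd R d -> R) : bmeas f ->
  Ex Pp (fun x => (1 - t x) * f x) = Ex Pm (fun x => (1 + t x) * f x).
Proof.
move=> bf; have b1 := bmeas_cst (T := Rd R d) (1 : R); have bt := bmeas_tfun.
rewrite (Ex_density dp); last by apply: bmeasM => //; exact: bmeasB.
rewrite (Ex_density dm); last by apply: bmeasM => //; exact: bmeasD.
apply: eq_Rintegral => x _; rewrite mulrAC [RHS]mulrAC; congr (_ * _).
have := rp0 x; have := rm0 x; rewrite /tfun => b a.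
have [s0|s0] := eqVneq (rp x + rm x) 0.
  have -> : rp x = 0 by lra.
  have -> : rm x = 0 by lra.
  by rewrite !mulr0.
by field.
Qed.

Section odd_functions.
Variable phi : R -> R.
Hypothesis bphi : bmeas (fun x => phi (t x)).
Hypothesis phi_odd : forall u, `|u| <= 1 -> phi (- u) = - phi u.

Let bphiN : bmeas (fun x => phi (- t x)).
Proof.
have := bmeasZ (-1) bphi; congr bmeas; apply/funext => x.
by rewrite phi_odd ?tfun_le1// mulN1r.
Qed.

Lemma Ex_odd_neg : Ex Pm (fun x => phi (t x)) = - Ex Pp (fun x => phi (t x)).
Proof.
rewrite Ex_reflect// -mulN1r -ExZ//; congr (Ex _ _); apply/funext => x.
by rewrite phi_odd ?tfun_le1// mulN1r.
Qed.

(** The density [(1 - t) rp] is symmetric under the exchange of the two laws, which reverses the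
    sign of [phi (t)]. The integral of [(1 - t) phi (t)] is therefore its own negative. *)
Lemma Ex_odd_tilt :
  Ex Pp (fun x => phi (t x)) = Ex Pp (fun x => t x * phi (t x)).
Proof.
have b1 := bmeas_cst (T := Rd R d) (1 : R); have bt := bmeas_tfun.
have btphi := bmeasM bt bphi.
have E1 : Ex Pp (fun x => phi (t x)) - Ex Pp (fun x => t x * phi (t x)) =
    Ex Pp (fun x => (1 - t x) * phi (t x)).
  by rewrite -ExB//; congr (Ex _ _); apply/funext => x; ring.
have E2 : Ex Pp (fun x => (1 - t x) * phi (t x)) =
    - Ex Pp (fun x => (1 - t x) * phi (t x)).
  rewrite {1}Ex_tilt// (Ex_reflect (phi := fun u => (1 + u) * phi u)).
  - rewrite -mulN1r -ExZ; last by apply: bmeasM => //; exact: bmeasB.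
    congr (Ex _ _); apply/funext => x; rewrite phi_odd ?tfun_le1//; ring.
  - by apply: bmeasM => //; exact: bmeasD.
  - by apply: bmeasM => //; exact: bmeasB.
lra.
Qed.

End odd_functions.

Section truncated_scores.
Variables (g : R) (k : nat).
Hypotheses (g_gt0 : 0 < g) (g_lt1 : g < 1) (k_gt0 : (0 < k)%N).

Local Notation M := (Mfun g rp rm k).

Let gk1 : 0 <= g ^+ k <= g.
Proof.
rewrite exprn_ge0 ?(ltW g_gt0)//=; case: k k_gt0 => // j _.
rewrite exprS -[leRHS]mulr1 ler_wpM2l ?(ltW g_gt0)//.
by apply: exprn_ile1; apply: ltW.
Qed.

Lemma Mfun_arg_le (u : R) : `|u| <= 1 -> `|g ^+ k * u| <= g ^+ k.
Proof.
move=> u1; have /andP[g0 _] := gk1.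
by rewrite normrM (ger0_norm g0) -[leRHS]mulr1 ler_wpM2l.
Qed.

Lemma Mfun_le x : `|M x| <= 2 * c_gamma g * g ^+ k.
Proof.
have /andP[g0 gg] := gk1; have h := Mfun_arg_le (tfun_le1 x).
rewrite /Mfun normrM ger0_norm// -mulrA ler_wpM2l//.
apply: le_trans (artanh_abs_le (le_trans h gg) g_lt1) _.
rewrite [leRHS]mulrC; apply: ler_pM => //; first by rewrite invr_ge0 subr_ge0 ltW.
have d0 : 0 < 1 - g by rewrite subr_gt0.
have d1 : 0 < 1 + g by rewrite addr_gt0.
(* The factor [1 / (1 - g)] from the bound on [artanh] is at most [c_gamma g], because
   [1 + g <= 2]. *)
rewrite /c_gamma (_ : 2 / (1 - g ^+ 2) = (1 - g)^-1 * (2 / (1 + g))); last first.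
  by field; do ![apply/andP; split]; apply: lt0r_neq0; nra.
by rewrite ler_peMr ?invr_ge0 ?(ltW d0)// ler_pdivlMr//; lra.
Qed.

Lemma bmeas_Mfun : bmeas M.
Proof.
split; last by exists (2 * c_gamma g * g ^+ k); exact: Mfun_le.
apply: measurable_funM; first exact: measurable_cst.
apply: measurable_fun_artanh => [x|].
  apply: le_trans (Mfun_arg_le (tfun_le1 x)) _; have /andP[_ +] := gk1.
  by move=> /le_trans; apply; exact: ltW.
by apply: measurable_funM; [exact: measurable_cst|exact: measurable_tfun].
Qed.

Let M_odd u : `|u| <= 1 -> 2 * artanh (g ^+ k * - u) = - (2 * artanh (g ^+ k * u)).
Proof.
move=> u1; rewrite mulrN artanhN ?mulrN// -ltr_norml.
by apply: le_lt_trans (Mfun_arg_le u1) _; have /andP[_ /le_lt_trans] := gk1; apply.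
Qed.

Lemma Ex_Mfun_label b : Ex (Q b) M = Ex Pp M * label b.
Proof.
case: b => /=; first by rewrite mulr1.
by rewrite mulrN1 -(Ex_odd_neg (phi := fun u => 2 * artanh (g ^+ k * u))) //; exact: bmeas_Mfun.
Qed.

Lemma Ex_Mfun_ge : 2 * g ^+ k * vartheta Pp rp rm <= Ex Pp M.
Proof.
rewrite (Ex_odd_tilt (phi := fun u => 2 * artanh (g ^+ k * u))) //; last exact: bmeas_Mfun.
have -> : vartheta Pp rp rm = Ex Pp (fun x => t x ^+ 2) by rewrite /vartheta unlock.
have bt := bmeas_tfun.
rewrite -ExZ; last exact: bmeas_sqr.
apply: le_Ex => [||x]; first exact/bmeasZ/bmeas_sqr.
  exact: bmeasM bt bmeas_Mfun.
have /andP[g0 gg] := gk1.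
have : g ^+ k * t x ^+ 2 <= t x * artanh (g ^+ k * t x).
  apply: mul_artanh_ge => //; apply: le_lt_trans g_lt1; apply: le_trans gg.
  by rewrite -[leRHS]mulr1 ler_wpM2l ?tfun_le1.
by move=> /=; lra.
Qed.

End truncated_scores.

Lemma measurable_Mfun0 (g : R) : measurable_fun setT (Mfun g rp rm 0).
Proof.
apply: measurable_funM; first exact: measurable_cst.
apply: measurable_fun_artanh => [x|]; first by rewrite expr0 mul1r tfun_le1.
by apply: measurable_funM; [exact: measurable_cst|exact: measurable_tfun].
Qed.

(* On this event the likelihood ratio is at most [expR (- lam)]. *)
Lemma root_tail (g lam : R) b : 0 < lam ->
  fine (Q b [set x | label b * Mfun g rp rm 0 x <= - lam]) <= expR (- lam).
Proof.
move=> lam0; set A := [set x | _].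
have mA : measurable A.
  rewrite -[X in measurable X]setTI; apply: measurable_fun_le => //.
  by apply: measurable_funM; [exact: measurable_cst|exact: measurable_Mfun0].
have key x : A x -> (if b then rp x else rm x) <= expR (- lam) * (if b then rm x else rp x).
  rewrite /A /= /Mfun expr0 mul1r /artanh {mA}; clear A.
  have -> : 2 * (ln ((1 + t x) / (1 - t x)) / 2) = ln ((1 + t x) / (1 - t x)) by field.
  (* If exactly one density vanishes, [t] is 1 or -1 and the score has the default value 0. As [lam]
     is positive, such a point is not in the event. *)
  have [a0|a0] := eqVneq (rp x) 0.
    case: b => H; first by rewrite a0 mulr_ge0// expR_ge0.
    move: H; have [b0|b0] := eqVneq (rm x) 0; first by rewrite b0 a0 mulr0.
    have -> : t x = -1 by rewrite /tfun a0 !add0r mulNr divff.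
    rewrite subrr mul0r ln0// mulr0; lra.
  have [b0|b0] := eqVneq (rm x) 0.
    case: b => H; last by rewrite b0 mulr_ge0// expR_ge0.
    move: H; have -> : t x = 1 by rewrite /tfun b0 addr0 subr0 divff.
    rewrite subrr invr0 mulr0 ln0// mulr0; lra.
  have a1 : 0 < rp x by rewrite lt0r a0 rp0.
  have b1 : 0 < rm x by rewrite lt0r b0 rm0.
  have -> : (1 + t x) / (1 - t x) = rp x / rm x.
    have s1 : rp x + rm x != 0 by rewrite gt_eqF// addr_gt0.
    rewrite /tfun; field; rewrite s1 b0 /=.
    by rewrite (_ : _ - _ = 2 * rm x) ?mulf_neq0//; ring.
  have r1 : 0 < rp x / rm x by rewrite divr_gt0.
  case: b => /=.
    by rewrite mul1r -ler_pdivrMr// -ler_expR lnK.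
  rewrite mulN1r -lnV ?posrE// invf_div -ler_pdivrMr// -ler_expR lnK//.
  by rewrite posrE divr_gt0.
pose r1 := if b then rp else rm; pose r2 := if b then rm else rp.
have d1 : density_of mu (Q b) r1 by rewrite /r1; case: (b).
have d2 : density_of mu (Q (~~ b)) r2 by rewrite /r2; case: (b).
apply: (@le_trans _ _ (expR (- lam) * fine (Q (~~ b) A))); last first.
  rewrite -[leRHS]mulr1 ler_wpM2l ?expR_ge0// -lee_fin fineK ?fin_num_measure//.
  exact: probability_le1.
rewrite -!Ex_indic// (Ex_density d1); last exact: bmeas_indic.
rewrite -ExZ; last exact: bmeas_indic.
rewrite (Ex_density d2); last exact/bmeasZ/bmeas_indic.
apply: le_Rintegral => //.
- by apply: (density_integrable d1); exact: bmeas_indic.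
- by apply: (density_integrable d2); exact/bmeasZ/bmeas_indic.
move=> x _; rewrite indicE; case: (boolP (x \in A)) => [|_]; last by rewrite mulr0 !mul0r.
rewrite inE => /key; rewrite mulr1 mul1r /r1 /r2; by case: (b).
Qed.

End densities.

(** * Weighted squares, limits of events and numerical bounds *)

Lemma weighted_cauchy_schwarz {R : realType} (n : nat) (a x : 'I_n -> R) :
  (forall i, 0 < a i) ->
  (\sum_i x i) ^+ 2 <= (\sum_i a i) * \sum_i (x i ^+ 2 / a i).
Proof.
move=> a0; set A := \sum_i a i; set S := \sum_i x i; set V := \sum_i _ / _.
have [A0|A0] := lerP A 0.
  case: n => [|n] in a x a0 A S V A0 *.
    by rewrite /S /A !big_ord0 expr0n mul0r.
  suff : 0 < A by move=> /lt_le_trans/(_ A0); rewrite ltxx.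
  rewrite /A (bigD1 ord0)//= ltr_pwDl//; apply: sumr_ge0 => i _; exact: ltW.
(* This is the nonnegative variance of the ratios [x i / a i] under the weights [a i], up to
   normalisation. *)
have : 0 <= \sum_i a i * (x i / a i - S / A) ^+ 2.
  by apply: sumr_ge0 => i _; rewrite mulr_ge0 ?sqr_ge0// ltW.
have -> : \sum_i a i * (x i / a i - S / A) ^+ 2 = V - S ^+ 2 / A.
  transitivity (\sum_i (x i ^+ 2 / a i + (- (2 * S / A) * x i + (S / A) ^+ 2 * a i))).
    by apply: eq_bigr => i _; field; rewrite !gt_eqF.
  rewrite !big_split /= -!mulr_sumr -/V -/S -/A; field.
  by rewrite gt_eqF.
by rewrite subr_ge0 ler_pdivrMr// mulrC.
Qed.

Lemma cvg_sum0 {R : realType} (l : nat) (F : 'I_l -> nat -> R) :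
  (forall i, F i n @[n --> \oo] --> (0 : R)) ->
  (\sum_(i < l) F i n) @[n --> \oo] --> (0 : R).
Proof.
elim: l F => [|l IHl] F F0.
  by under eq_fun do rewrite big_ord0; exact: cvg_cst.
under eq_fun do rewrite big_ord_recr /=.
have := cvgD (IHl _ (fun i => F0 (widen_ord (leqnSn l) i))) (F0 ord_max).
by rewrite addr0; exact.
Qed.

(** [E] is the increasing union over [N] of the events that [A n] holds for all [n >= N]. Each lies
    in [A n] for large [n], so its probability is at most [r], and continuity from below concludes.
    The index [N] may depend on the point. *)
Lemma probability_eventually_le {R : realType} {d : measure_display}
    {T : measurableType d} (P : probability T R) (A : nat -> set T) (E : set T)
    (q : nat -> R) (r : R) :
  (forall n, measurable (A n)) -> (forall n, (P (A n) <= (q n)%:E)%E) ->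
  q n @[n --> \oo] --> r ->
  (forall x, exists N, forall n, (N <= n)%N -> A n x <-> E x) ->
  (P E <= r%:E)%E.
Proof.
move=> mA Aq qr AE.
pose F N := \bigcap_(n in [set n | (N <= n)%N]) A n.
have mF N : measurable (F N).
  apply: bigcap_measurable => //; by exists N => /=.
have -> : E = \bigcup_N F N.
  apply/seteqP; split => x.
    by have [N H] := AE x => Ex; exists N => // n /= /H ->.
  have [N H] := AE x => -[M _ FM]; apply/(H (maxn M N)).
    exact: leq_maxr.
  by apply: FM => /=; exact: leq_maxl.
have FP N : (P (F N) <= r%:E)%E.
  rewrite -[leLHS]fineK ?fin_num_measure// lee_fin.
  apply: (cvgr_to_ge qr); near=> n.
  rewrite -lee_fin fineK ?fin_num_measure//; apply: le_trans (Aq n).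
  apply: le_measure; rewrite ?inE//.
  by move=> x; apply => /=; near: n; exact: nbhs_infty_ge.
have c : (P \o F) n @[n --> \oo] --> P (\bigcup_N F N).
  apply: nondecreasing_cvg_mu => //; first exact: bigcupT_measurable.
  move=> m n mn; apply/subsetPset => x Fx k /= nk; apply: Fx => /=.
  exact: leq_trans nk.
by apply: (cvge_to_le c); apply: nearW => n /=; exact: FP.
Unshelve. all: by end_near. Qed.

Lemma geom_sum_le {R : realType} (kap : R) (l : nat) : 1 < kap ->
  \sum_(k < l) kap ^+ k.+1 <= kap ^+ l.+1 / (kap - 1).
Proof.
move=> k1; have k0 : 0 < kap - 1 by rewrite subr_gt0.
rewrite ler_pdivlMr//.
suff -> : (\sum_(k < l) kap ^+ k.+1) * (kap - 1) = kap ^+ l.+1 - kap by lra.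
elim: l => [|l IHl]; first by rewrite big_ord0; ring.
by rewrite big_ord_recr /= mulrDl IHl !exprS; ring.
Qed.

(* The second-moment term is [4 / 9] of [(l * K)^-1]; for [K <= 2] the right-hand
   side exceeds 1. *)
Lemma second_moment_numeric {R : realType} (l : nat) (K z x : R) :
  (1 <= l)%N -> 0 < K -> 0 < z -> x <= 1 -> x <= 4 / 9 / (l%:R * K) ->
  x <= 2 * z + expR (- (K * z)).
Proof.
move=> l1 K0 z0 x1 xK; have l1' : 1 <= l%:R :> R by rewrite ler1n.
have [K2|K2] := lerP K 2.
  have := expR_ge1Dx (- (K * z)).
  have : K * z <= 2 * z by rewrite ler_pM2r.
  lra.
have xK' : x * (9 * K) <= 4.
  have h : x * (l%:R * K) <= 4 / 9 by rewrite -ler_pdivlMr ?mulr_gt0//; lra.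
  have [x0|x0] := lerP 0 x.
    have : x * K <= x * (l%:R * K).
      by apply: ler_wpM2l => //; rewrite ler_peMl// ltW.
    lra.
  have : x * K < 0 by rewrite nmulr_rlt0.
  lra.
(* If [K z >= 1 / 4], then [2 z >= 1 / (2 K)], which exceeds [4 / (9 K)]. Otherwise the exponential
   is at least [3 / 4], while [K > 2] makes [x] at most [1 / 2]. *)
have [Kz|Kz] := lerP (1 / 4) (K * z).
  have e0 := expR_gt0 (- (K * z)).
  suff : x <= 2 * z by lra.
  rewrite -(ler_pM2r K0); lra.
have := expR_ge1Dx (- (K * z)).
have : x <= 1 / 2 by rewrite -(ler_pM2r K0); lra.
lra.
Qed.

(** * Exhaustion of the tree by finite alphabets *)

Section truncation.
Context {R : realType} {d : nat} {dO : measure_display}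
  {Omega : measurableType dO} {P : probability Omega R}.
Variables (C : seq nat -> {RV P >-> nat}) (X : seq nat -> {RV P >-> Rd R d}).

Lemma in_tree_words (c : seq nat -> nat) n v :
  (forall u, (size u < size v)%N -> in_tree c u -> (c u <= n)%N) ->
  in_tree c v -> in_tree (fun=> n) v.
Proof.
elim: v => //= i u IHu H /andP[uT iu]; rewrite IHu//=; last first.
  by move=> u' su'; apply: H; rewrite ltnS ltnW.
by apply: leq_trans iu _; exact: H.
Qed.

Lemma level_sum_eventually (f : Rd R d -> R) (w : Omega) l : exists N,
  forall n k, (N <= n)%N -> (k < l)%N ->
  level_sum (C := C) (X := X) f n k w =
  \sum_(v <- level (fun v => C v w) k) f (X v w).
Proof.
pose c v := C v w.
(* The total offspring of the levels below [l] dominates each single offspring number there, hence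
   each letter of a vertex on these levels. *)
exists (\sum_(j < l) \sum_(u <- level c j) c u)%N => n k Nn kl.
rewrite /level_sum.
have -> : \sum_(u <- words n k) tree_term (C := C) (X := X) f u w =
    \sum_(u <- words n k | in_tree c u) f (X u w).
  rewrite [RHS]big_mkcond; apply: eq_bigr => u _.
  by rewrite /tree_term; case: in_tree; rewrite ?mul1r ?mul0r.
rewrite -big_filter; apply: perm_big; apply: uniq_perm.
- by rewrite filter_uniq// words_uniq.
- exact: level_uniq.
move=> v; rewrite mem_filter !mem_level.
have [vT /=|//] := boolP (in_tree c v).
case: eqP => [sv|]; last by rewrite andbF.
rewrite andbT; apply/(in_tree_words _ vT) => u; rewrite sv => uk uT.
apply: leq_trans Nn.
have ul := ltn_trans uk kl.
rewrite (bigD1 (Ordinal ul))//= (bigD1_seq u) ?level_uniq//=; last first.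
  by rewrite mem_level uT eqxx.
by rewrite -addnA leq_addr.
Qed.

End truncation.

(** * Bound on the error probability *)

Section error_bound.
Context {R : realType} {d : nat} {dO : measure_display}
  {Omega : measurableType dO} {P : probability Omega R} {Dl g : R}
  {Pp Pm : probability (Rd R d) R}
  {C : seq nat -> {RV P >-> nat}} {y : seq nat -> {RV P >-> bool}}
  {X : seq nat -> {RV P >-> Rd R d}}
  {mu : {measure set (Rd R d) -> \bar R}} {rp rm : Rd R d -> R} {l : nat}.
Hypotheses (lim : limit_object Dl g Pp Pm C y X) (A1 : assumption1 mu Pp Pm rp rm).
Hypotheses (Dl_gt0 : 0 < Dl) (g_gt0 : 0 < g) (g_lt1 : g < 1) (l_gt0 : (0 < l)%N).
Local Notation theta := (vartheta Pp rp rm).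
Local Notation kap := (g ^+ 2 * Dl).
Hypotheses (theta_gt0 : 0 < theta) (kap_gt1 : 1 < kap).

Local Notation M := (Mfun g rp rm).
Local Notation sg := (label_at (y := y)).
Local Notation mean k := (Ex Pp (M k)).
Local Notation lsum := (level_sum (C := C) (X := X)).

(** The ordinal [k] stands for level [k + 1], so that the root is left out. *)
Let w (k : 'I_l) : R := mean k.+1 * (g * Dl) ^+ k.+1.
Let W : R := \sum_k w k.
(** Cauchy-Schwarz weights with two uses: [a k >= w k] tames [w k ^+ 2 / (kap - 1)], and
    [a k >= W / l] tames the fluctuation term [kap ^+ k.+1]. Their sum is only [2 * W]. *)
Let a (k : 'I_l) : R := w k + W / l%:R.
Let dev n (k : 'I_l) o : R := sg [::] o * lsum (M k.+1) n k.+1 o - w k.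
Let V n o : R := \sum_k dev n k o.
(** At most [W / 4], by [W_ge]. *)
Let lam : R := theta / 2 * kap ^+ l.
(** The factor [32 / 9] is 2, from the sum [2 * W] of the weights, times [(4 / 3)^2], from Chebyshev
    at [3 / 4 * W]. *)
Let main_term : R := 32 / 9 / W *
  (4 * c_gamma g ^+ 2 * l%:R / W * (kap ^+ l.+1 / (kap - 1)) + W / (kap - 1)).
Let excess n (k : 'I_l) : R :=
  2 * w k * (w k - mean k.+1 * (g * trunc_mean (Dl := Dl) n) ^+ k.+1).
Let rest n : R := 32 / 9 / W * \sum_k (excess n k / a k).

Let kap1 : 0 < kap - 1. Proof. by rewrite subr_gt0. Qed.
Let kap0 : 0 < kap. Proof. by apply: lt_trans kap_gt1. Qed.
Let l0 : 0 < l%:R :> R. Proof. by rewrite ltr0n. Qed.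

Let w_ge (k : 'I_l) : 2 * theta * kap ^+ k.+1 <= w k.
Proof.
have -> : 2 * theta * kap ^+ k.+1 = 2 * g ^+ k.+1 * theta * (g * Dl) ^+ k.+1.
  by rewrite !exprMn; ring.
apply: ler_wpM2r; first by rewrite exprn_ge0// mulr_ge0// ltW.
exact: (Ex_Mfun_ge A1).
Qed.

Let w_gt0 k : 0 < w k.
Proof. by apply: lt_le_trans (w_ge k); rewrite !mulr_gt0// exprn_gt0. Qed.

Let W_ge : 2 * theta * kap ^+ l <= W.
Proof.
case: l l_gt0 w w_ge w_gt0 @W => // j _ w' w'_ge w'_gt0 W'.
(* The last level alone gives the bound, the other means being positive. *)
apply: le_trans (w'_ge ord_max) _.
rewrite /W' (bigD1 ord_max)//= lerDl; apply: sumr_ge0 => i _; exact: ltW.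
Qed.

Let W_gt0 : 0 < W.
Proof. by apply: lt_le_trans W_ge; rewrite !mulr_gt0// exprn_gt0. Qed.

Let a_gt0 k : 0 < a k.
Proof. by rewrite addr_gt0// divr_gt0. Qed.

Let sum_a : \sum_k a k = 2 * W.
Proof.
rewrite big_split /= sumr_const card_ord -[W / _ *+ _]mulr_natr divfK ?gt_eqF//.
by rewrite -/W; ring.
Qed.

Let bM (k : 'I_l) : bmeas (M k.+1).
Proof. exact: (bmeas_Mfun A1). Qed.

Let bL n (k : 'I_l) : bmeas (lsum (M k.+1) n k.+1).
Proof. exact: (bmeas_level_sum lim). Qed.

Let bdev n k : bmeas (dev n k).
Proof.
apply: bmeasB; last exact: bmeas_cst.
exact: bmeasM (bmeas_label_at [::]) (bL n k).
Qed.

Let dev_moment n k : Ex P (fun o => dev n k o ^+ 2) <=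
  4 * c_gamma g ^+ 2 * kap ^+ k.+1 + w k ^+ 2 / (kap - 1) + excess n k.
Proof.
have h := Ex_level_dev lim Dl_gt0 (bM k) (Ex_Mfun_label A1 g_gt0 g_lt1 (ltn0Sn k))
  (Mfun_le A1 g_gt0 g_lt1 (ltn0Sn k)) n (ltn0Sn k) kap_gt1 (ltW g_gt0).
apply: le_trans h _; rewrite /excess -/(w k).
have -> : (2 * c_gamma g * g ^+ k.+1) ^+ 2 * Dl ^+ k.+1 =
    4 * c_gamma g ^+ 2 * kap ^+ k.+1.
  by rewrite [(g ^+ 2 * Dl) ^+ _]exprMn -!exprM mulnC exprM; ring.
exact: lexx.
Qed.

Let V_moment n : Ex P (fun o => V n o ^+ 2) <=
  2 * W * ((4 * c_gamma g ^+ 2 * l%:R / W * (kap ^+ l.+1 / (kap - 1)) + W / (kap - 1))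
    + \sum_k excess n k / a k).
Proof.
have bd k : bmeas (fun o => dev n k o ^+ 2 / a k).
  by apply: bmeasM; [exact: bmeas_sqr|exact: bmeas_cst].
have bV : bmeas (V n) by exact: bmeas_sum.
apply: (@le_trans _ _ (Ex P (fun o => 2 * W * \sum_k (dev n k o ^+ 2 / a k)))).
  apply: le_Ex; [exact: bmeas_sqr|exact/bmeasZ/bmeas_sum|].
  by move=> o; rewrite -sum_a; exact: weighted_cauchy_schwarz.
rewrite ExZ; last exact: bmeas_sum.
rewrite Ex_sum//; apply: ler_wpM2l; first by rewrite mulr_ge0// ltW.
have step : \sum_(k < l) Ex P (fun o => dev n k o ^+ 2 / a k) <=
    \sum_(k < l) (4 * c_gamma g ^+ 2 * l%:R / W * kap ^+ k.+1 + w k / (kap - 1)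
      + excess n k / a k).
  apply: ler_sum => k _.
  under eq_fun do rewrite mulrC.
  rewrite ExZ; last exact/bmeas_sqr.
  apply: (@le_trans _ _ ((a k)^-1 * (4 * c_gamma g ^+ 2 * kap ^+ k.+1
      + w k ^+ 2 / (kap - 1) + excess n k))).
    by apply: ler_wpM2l => //; rewrite invr_ge0 ltW.
  rewrite mulrDr [(a k)^-1 * excess n k]mulrC lerD2r mulrDr; apply: lerD.
    have -> : 4 * c_gamma g ^+ 2 * l%:R / W * kap ^+ k.+1 =
        (W / l%:R)^-1 * (4 * c_gamma g ^+ 2 * kap ^+ k.+1).
      by field; rewrite !gt_eqF.
    apply: ler_wpM2r.
      by rewrite mulr_ge0 ?exprn_ge0 ?(ltW kap0)// mulr_ge0// sqr_ge0.
    by rewrite lef_pV2 ?posrE ?divr_gt0// lerDr ltW.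
  rewrite mulrA; apply: ler_wpM2r; first by rewrite invr_ge0 ltW.
  rewrite mulrC ler_pdivrMr// expr2; apply: ler_wpM2l; first exact: ltW.
  by rewrite lerDl ltW// divr_gt0.
apply: le_trans step _.
rewrite !big_split /= -mulr_sumr -mulr_suml -/W !lerD2r.
apply: ler_wpM2l; last exact: geom_sum_le.
by apply: divr_ge0; [do 2 apply: mulr_ge0 => //; exact: sqr_ge0|exact: ltW].
Qed.

Let V_tail n : fine (P [set o | V n o <= - (3 / 4 * W)]) <= main_term + rest n.
Proof.
have bV : bmeas (V n) by exact: bmeas_sum.
have r0 : 0 < 3 / 4 * W by rewrite mulr_gt0.
apply: le_trans (chebyshev_Ex P bV r0) _.
rewrite ler_pdivrMr ?exprn_gt0//; apply: le_trans (V_moment n) _.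
rewrite /main_term /rest -mulrDr.
set Z := _ + \sum_k _; rewrite le_eqVlt; apply/orP; left; apply/eqP.
by field; rewrite gt_eqF.
Qed.

Let rest_cvg : rest n @[n --> \oo] --> (0 : R).
Proof.
rewrite /rest -[X in _ --> X](mulr0 (32 / 9 / W)); apply: cvgMr.
apply: cvg_sum0 => k; rewrite -[X in _ --> X](mul0r (a k)^-1); apply: cvgMl.
rewrite /excess -[X in _ --> X](mulr0 (2 * w k)); apply: cvgMr.
rewrite -[X in _ --> X](subrr (w k)); apply: cvgB; first exact: cvg_cst.
apply: cvgMr; apply: (@cvg_comp _ _ _ _ (fun x : R => x ^+ k.+1) _ (nbhs (g * Dl))).
  by apply: cvgMr; exact: trunc_mean_cvg.
exact: exprn_continuous.
Qed.

Let measurable_root b : measurable [set x | label b * M 0 x <= - lam].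
Proof.
rewrite -[X in measurable X]setTI; apply: measurable_fun_le => //.
by apply: measurable_funM; [exact: measurable_cst|exact: (measurable_Mfun0 A1)].
Qed.

Let lam_gt0 : 0 < lam.
Proof. by rewrite mulr_gt0 ?exprn_gt0// divr_gt0. Qed.

Let measurable_root_event : measurable [set o | sg [::] o * M 0 (X [::] o) <= - lam].
Proof.
rewrite -[X in measurable X]setTI; apply: measurable_fun_le => //.
apply: measurable_funM; first by have [] := bmeas_label_at (y := y) [::].
by apply: measurableT_comp; [exact: (measurable_Mfun0 A1)|].
Qed.

(** For each value of the root label the event is a cylinder over the one-vertex subtree, and each
    value has probability [1 / 2]. *)
Let root_event : fine (P [set o | sg [::] o * M 0 (X [::] o) <= - lam]) <= expR (- lam).
Proof.
pose A b : set (Rd R d) := [set x | label b * M 0 x <= - lam].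
pose E b := cyl C y X [:: [::]] (fun=> predT) (fun=> b) (fun=> A b).
have fF : forced [:: [::]] (fun=> predT) by apply: forcedP => //; split.
have mE b : measurable (E b) by apply: measurable_cyl => v; exact: measurable_root.
have PE b : fine (P (E b)) <= expR (- lam) / 2.
  have mAb (v : seq nat) : measurable (A b) := measurable_root b.
  rewrite /E (cyl_prob lim Dl_gt0 _ fF (A := fun=> A b) mAb) !big_seq1 /= poi_predT mul1r.
  rewrite mulrC mul1r; apply: ler_wpM2r => //.
  exact: (root_tail A1).
apply: (@le_trans _ _ (fine (P (E true)) + fine (P (E false)))); last first.
  by have := PE true; have := PE false; lra.
rewrite -lee_fin EFinD !fineK ?fin_num_measure//.
apply: le_trans (measureU2 _ (mE _) (mE _)).
apply: le_measure; rewrite ?inE//; first exact: measurableU.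
move=> o /= H; have : E (y [::] o) o.
  by move=> v; rewrite inE => /eqP ->; split.
by case: (y [::] o); [left|right].
Qed.

Lemma error_prob_le : (error_prob g rp rm C y X l <= (Num.min 1 (main_term + expR (- lam)))%:E)%E.
Proof.
pose T n o := M 0 (X [::] o) + \sum_(k < l) lsum (M k.+1) n k.+1 o.
pose A n := [set o | sg [::] o * T n o <= 0].
have bV n : bmeas (V n) by exact: bmeas_sum.
have mV n : measurable [set o | V n o <= - (3 / 4 * W)].
  by rewrite -[X in measurable X]setTI; apply: measurable_fun_le => //; case: (bV n).
have mA n : measurable (A n).
  rewrite -[X in measurable X]setTI; apply: measurable_fun_le => //.
  apply: measurable_funM; first by have [] := bmeas_label_at (y := y) [::].
  apply: measurable_funD.
    by apply: measurableT_comp; [exact: (measurable_Mfun0 A1)|].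
  by have [] : bmeas (fun o => \sum_(k < l) lsum (M k.+1) n k.+1 o) by exact: bmeas_sum.
suff ev x : exists N, forall n, (N <= n)%N -> A n x <-> label (y [::] x) *
    Tstat g rp rm (fun v => C v x) (fun v => X v x) l <= 0.
  (* The bound 1 is kept for the numerical lemma. It too passes through the truncated events, as the
     error event is reached only as their limit. *)
  rewrite /Num.min; case: ifP => _.
    apply: (probability_eventually_le (A := A) (q := cst 1)) => //.
      by move=> n; exact: probability_le1.
    exact: cvg_cst.
  apply: (probability_eventually_le (A := A)
    (q := fun n => main_term + rest n + expR (- lam))) => //; last first.
    rewrite -[X in _ --> main_term + X]add0r addrA; apply: cvgD; last exact: cvg_cst.
    by apply: cvgD; [exact: cvg_cst|exact: rest_cvg].
  move=> n; apply: (@le_trans _ _ (P ([set o | V n o <= - (3 / 4 * W)] `|`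
      [set o | sg [::] o * M 0 (X [::] o) <= - lam]))).
    apply: le_measure; rewrite ?inE//; first exact: measurableU.
    move=> o /= AT; have [h|h] := lerP (V n o) (- (3 / 4 * W)); [by left|right].
    have VE : V n o = sg [::] o * (\sum_(k < l) lsum (M k.+1) n k.+1 o) - W.
      by rewrite /V sumrB -mulr_sumr.
    move: AT; rewrite /A /= /T mulrDr.
    have : lam <= W / 4 by move: W_ge; rewrite /lam; lra.
    by move: h; rewrite VE; lra.
  apply: le_trans (measureU2 _ (mV n) measurable_root_event) _.
  rewrite EFinD; apply: leeD.
    by rewrite -[leLHS]fineK ?fin_num_measure// lee_fin; exact: V_tail.
  by rewrite -[leLHS]fineK ?fin_num_measure// lee_fin.
move: x => o.
(* The score depends on the level, so each level comes with its own threshold; their maximum serves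
   all levels. *)
have H (k : nat) : exists N, forall n, (N <= n)%N -> forall j : 'I_l, (j < k)%N ->
    lsum (M j.+1) n j.+1 o = \sum_(v <- level (fun v => C v o) j.+1) M j.+1 (X v o).
  elim: k => [|k [N HN]]; first by exists 0.
  have [N' HN'] := level_sum_eventually C X (M k.+1) o k.+2.
  exists (maxn N N') => n; rewrite geq_max => /andP[nN nN'] j.
  rewrite ltnS leq_eqVlt => /orP[/eqP jk|]; last exact: HN.
  by rewrite jk; exact: HN'.
have [N HN] := H l; exists N => n Nn.
rewrite /A /= /T /Tstat big_ord_recl /= big_seq1.
by under eq_bigr => j _ do rewrite (HN n Nn j (ltn_ord j)).
Qed.

(** In [main_term] the part with [kap - 1] alone is free of [W], and the other decreases in [W].
    Inserting the lower bound [2 * theta * kap ^+ l] for [W] turns the latter into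
    [4 / 9 / (l%:R * K)], which explains [c_zero]. *)
Lemma error_prob_le_geom (K := c_zero g theta * (kap - 1) * (kap ^+ l / kap / l%:R ^+ 2)) :
  (error_prob g rp rm C y X l <= (Num.min 1
   (32 / 9 / (kap - 1) + 4 / 9 / (l%:R * K) + expR (- (theta / 2 * kap ^+ l))))%:E)%E.
Proof.
apply: le_trans error_prob_le _; rewrite lee_fin le_min ge_min lexx/= ge_min lerD2r.
apply/orP; right.
have c0 : 0 < c_gamma g.
  by rewrite /c_gamma divr_gt0// subr_gt0 expr_lt1// ltW.
have kl0 : 0 < kap ^+ l by rewrite exprn_gt0.
have -> : main_term = 32 / 9 / (kap - 1) +
    128 / 9 * c_gamma g ^+ 2 * l%:R * kap ^+ l.+1 / (kap - 1) / W ^+ 2.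
  rewrite /main_term; have := kap1; have := W_gt0; set k1 := kap - 1.
  by set k2 := kap ^+ l.+1 => ? ?; field; rewrite !gt_eqF.
have -> : 4 / 9 / (l%:R * K) = 128 / 9 * c_gamma g ^+ 2 * l%:R * kap ^+ l.+1 /
    (kap - 1) / (2 * theta * kap ^+ l) ^+ 2.
  rewrite /K /c_zero [kap ^+ l.+1]exprS; have := kap1; have := kap0; have := kl0.
  set k1 := kap - 1; set k2 := kap ^+ l; set k := kap => ? ? ?.
  by field; rewrite !gt_eqF.
rewrite lerD2l; apply: ler_wpM2l.
  apply: divr_ge0; last exact: ltW.
  have kl1 : 0 <= kap ^+ l.+1 by exact/exprn_ge0/ltW.
  by do 3 apply: mulr_ge0 => //; exact: sqr_ge0.
rewrite lef_pV2 ?posrE ?exprn_gt0//; last by rewrite !mulr_gt0.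
by rewrite lerXn2r// nnegrE ltW// !mulr_gt0.
Qed.

End error_bound.

Theorem theorem3p3 (R : realType) (a b : R) (d : nat)
    (mu : {measure set (Rd R d) -> \bar R})
    (Pp Pm : probability (Rd R d) R) (rp rm : Rd R d -> R)
    (dO : measure_display) (Omega : measurableType dO)
    (P : probability Omega R)
    (C : seq nat -> {RV P >-> nat}) (y : seq nat -> {RV P >-> bool})
    (X : seq nat -> {RV P >-> Rd R d})
    (theta := vartheta Pp rp rm) (g := gamma a b) (kap := kappa a b) :
  0 < b -> b < a -> 1 < Delta a b ->
  limit_object (Delta a b) g Pp Pm C y X ->
  assumption1 mu Pp Pm rp rm ->
  0 < theta ->
  1 < kap ->
  forall (l : nat) (s : R), (1 <= l)%N -> 0 < s -> s < 1 ->
  (error_prob g rp rm C y X l <=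
   (16 / (kap - 1)
    + 2 * kap `^ (- (s * l%:R))
    + expR (- (c_zero g theta * (kap - 1)
               * (kap `^ ((1 - s) * l%:R - 1) / l%:R ^+ 2)))
    + expR (- (theta / 2 * kap ^+ l)))%:E)%E.
Proof.
move=> b0 ba D1 lim A1 theta0 kap1 l s l1 s0 s1.
have ab0 : 0 < a + b by lra.
have g0 : 0 < g by rewrite /g /gamma divr_gt0//; lra.
have g1 : g < 1 by rewrite /g /gamma ltr_pdivrMr//; lra.
have Dl0 : 0 < Delta a b by lra.
have kap0 : 0 < kap by lra.
have k10 : 0 < kap - 1 by lra.
have l0 : 0 < l%:R :> R by rewrite ltr0n.
have c0 : 0 < c_gamma g.
  by rewrite /c_gamma divr_gt0// subr_gt0 expr_lt1// ltW.
pose K := c_zero g theta * (kap - 1) * (kap ^+ l / kap / l%:R ^+ 2).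
(* The only place where [s] is chosen into the argument: the exponent of the statement is [K * z],
   and its second term is [2 * z]. *)
pose z := kap `^ (- (s * l%:R)).
have K0 : 0 < K.
  have cz0 : 0 < c_zero g theta.
    by apply: divr_gt0; [exact: exprn_gt0|apply: mulr_gt0 => //; exact: exprn_gt0].
  have h : 0 < kap ^+ l / kap / l%:R ^+ 2.
    by apply: divr_gt0; [apply: divr_gt0|]; rewrite ?exprn_gt0.
  by apply: mulr_gt0 => //; exact: mulr_gt0.
have z0 : 0 < z by rewrite powR_gt0.
have kapN0 : kap != 0 by rewrite gt_eqF.
have KzE : c_zero g theta * (kap - 1) * (kap `^ ((1 - s) * l%:R - 1) / l%:R ^+ 2) = K * z.
  have -> : (1 - s) * l%:R - 1 = l%:R - 1 + - (s * l%:R) by ring.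
  rewrite powRD; last by rewrite kapN0 implybT.
  rewrite powRB; last by rewrite kapN0 implybT.
  by rewrite powR_mulrn ?powRr1 ?ltW// /K /z; ring.
have bound := error_prob_le_geom lim A1 Dl0 g0 g1 l1 theta0 kap1.
cbv zeta in bound; rewrite -/(kappa a b) -/kap -/theta -/K in bound.
set p := error_prob g rp rm C y X l in bound *.
have p0 : (0 <= p)%E by exact: measure_ge0.
have pf : p \is a fin_num by rewrite ge0_fin_numE// (le_lt_trans bound)// ltry.
rewrite -[leLHS](fineK pf) lee_fin KzE.
have := bound; rewrite -[X in (X <= _)%E](fineK pf) lee_fin le_min => /andP[p1 pB].
have e0 := expR_ge0 (- (theta / 2 * kap ^+ l)).
have q0 : 0 <= 32 / 9 / (kap - 1) by rewrite divr_ge0// ltW.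
have q16 : 32 / 9 / (kap - 1) <= 16 / (kap - 1).
  by apply: ler_wpM2r; [rewrite invr_ge0 ltW|lra].
(* What remains after removing two nonnegative terms is still at most 1, as the numerical lemma
   demands. *)
have : fine p - 32 / 9 / (kap - 1) - expR (- (theta / 2 * kap ^+ l)) <=
    2 * z + expR (- (K * z)).
  by apply: (second_moment_numeric l1 K0 z0); lra.
by rewrite /z; lra.
Qed.
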